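(* Let $\Omega\subset\mathbb{R}^n$, $n\geq 2$, be a convex bounded smooth domain, write $M=\bar\Omega$ and $SM=M\times S^{n-1}$, and let $N\geq 2$. Suppose the sets $\mathscr{I},\mathscr{F}\subset\mathbb{C}^N$ give ideal data. Assume that for every continuous weight $W\colon SM\to SU(N^2)$ the weighted X-ray transform $\mathcal{I}_W$ is injective on continuous functions $M\to\mathbb{C}^{N^2}$. Then for continuous, pointwise hermitean $H\colon M\to\mathbb{C}^{N\times N}$, the data consisting of $|a^*U_H^\gamma b|$ for all $a\in\mathscr{F}$, $b\in\mathscr{I}$ and every line $\gamma\colon[0,T]\to\bar\Omega$ through $\Omega$ uniquely determines the trace free part of $H$. That is, if $H,\tilde H\colon M\to\mathbb{C}^{N\times N}$ are continuous and pointwise hermitean and $|a^*U_H^\gamma b|=|a^*U_{\tilde H}^\gamma b|$ for all such $a,b,\gamma$, then $H-\frac1N\operatorname{tr}(H)I=\tilde H-\frac1N\operatorname{tr}(\tilde H)I$ on $M$.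
   Context: A line through $\Omega$ is a unit speed line segment $\gamma\colon[0,T]\to\bar\Omega$ with endpoints on $\partial\Omega$. The time evolution operator $U_H^\gamma(t_2,t_1)\in U(N)$ is the solution operator of $i\Psi'(t)=H(\gamma(t))\Psi(t)$, $\Psi(t)\in\mathbb{C}^N$, so that $\Psi(t_2)=U_H^\gamma(t_2,t_1)\Psi(t_1)$ for every solution; $U_H^\gamma:=U_H^\gamma(T,0)$. A pair of subsets $\mathscr{I},\mathscr{F}\subset\mathbb{C}^N$ gives ideal data if for any two unitary $N\times N$ matrices $U$ and $V$, the condition $|a^*Ub|=|a^*Vb|$ for all $a\in\mathscr{F}$ and $b\in\mathscr{I}$ implies $U=e^{i\phi}V$ for some $\phi\in\mathbb{R}$. For a continuous $W\colon SM\to\mathbb{C}^{m\times m}$ and a continuous $f\colon M\to\mathbb{C}^m$, the $W$-weighted X-ray transform is $\mathcal{I}_Wf(\gamma)=\int_0^TW(\gamma(t),\dot\gamma(t))f(\gamma(t))\,dt$ for every unit speed line $\gamma\colon[0,T]\to M$ with endpoints on $\partial M$. Injectivity means that $\mathcal{I}_Wf=0$ (for all such $\gamma$) implies $f=0$. *)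

(* Defs.v *)
From HB Require Import structures.
From mathcomp Require Import all_boot all_order all_algebra.
From mathcomp Require Import complex.
From mathcomp Require Import all_classical all_reals all_analysis.
Import numFieldNormedType.Exports.

Set Implicit Arguments.
Unset Strict Implicit.
Unset Printing Implicit Defensive.

Import Order.TTheory GRing.Theory Num.Theory.
Local Open Scope classical_set_scope.
Local Open Scope ring_scope.
Local Open Scope sesquilinear_scope.

(* The analysis library equips abstract numeric fields, but not [R[i]], with
   the topology of their norm; these are the same copies of [R[i]^o] that
   [numFieldNormedType] makes. Complex matrices inherit their topology. *)
Section complex_topology.
Variable R : rcfType.

#[non_forgetful_inheritance]
HB.instance Definition _ := PseudoPointedMetric.copy R[i] R[i]^o.
#[non_forgetful_inheritance]
HB.instance Definition _ := GRing.ComAlgebra.copy R[i] R[i]^o.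
#[non_forgetful_inheritance]
HB.instance Definition _ := Vector.copy R[i] R[i]^o.
#[non_forgetful_inheritance]
HB.instance Definition _ := NormedModule.copy R[i] R[i]^o.

End complex_topology.

Section domains.
Variables (R : realType) (n : nat).
Implicit Types (A V Omega : set 'rV[R]_n) (f rho : 'rV[R]_n -> R).

(* The library norm of ['rV[R]_n] is the sup norm. *)
Definition euclidean_norm (v : 'rV[R]_n) : R :=
  Num.sqrt (\sum_(i < n) v ord0 i ^+ 2).

Definition sphere : set 'rV[R]_n := [set v | euclidean_norm v = 1].

Definition boundary A : set 'rV[R]_n := closure A `\` interior A.

(* [V] is meant to be open *)
Fixpoint Ck_on (k : nat) V f : Prop :=
  if k is j.+1 then
    forall i : 'I_n,
      (forall x, V x -> derivable f x (delta_mx ord0 i)) /\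
      Ck_on j V (fun x => 'D_(delta_mx ord0 i) f x)
  else forall x, V x -> {for x, continuous f}.

Definition smooth_on V f := forall k, Ck_on k V f.

(* Near each boundary point the set is the sublevel set of a smooth function
   with nonvanishing differential. *)
Definition smooth_boundary Omega :=
  forall p, boundary Omega p ->
    exists V rho,
      [/\ open V, V p, smooth_on V rho,
          Omega `&` V = [set x | rho x < 0] `&` V &
          exists i : 'I_n, 'D_(delta_mx ord0 i) rho p != 0].

Record convex_bounded_smooth_domain Omega : Prop := ConvexBoundedSmoothDomain {
  domain_open : open Omega ;
  domain_nonempty : Omega !=set0 ;
  domain_connected : connected Omega ;
  domain_convex : convex_set (Omega : set (convex_lmodType 'rV[R]_n)) ;
  domain_bounded : bounded_set Omega ;
  domain_smooth : smooth_boundary Omega }.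

Definition segment_path (x v : 'rV[R]_n) (t : R) : 'rV[R]_n := x + t *: v.

(* [segment_path x v], restricted to [[0, T]], is a line through [Omega] *)
Definition line_through Omega (x v : 'rV[R]_n) (T : R) :=
  [/\ 0 < T, sphere v,
      forall t, 0 <= t <= T -> closure Omega (segment_path x v t),
      boundary Omega (segment_path x v 0) &
      boundary Omega (segment_path x v T)].

End domains.

Section evolution.
Variables (R : realType) (N : nat).
Implicit Types (G : R -> 'M[R[i]]_N) (Psi : R -> 'cV[R[i]]_N).

(* derivative relative to [[0, T]], hence one-sided at the endpoints *)
Definition has_derivative_on (T : R) Psi (t : R) (D : 'cV[R[i]]_N) :=
  (((s - t)^-1)%:C%C *: (Psi s - Psi t))
    @[s --> within [set` `[0, T]] t^'] --> D.

Definition schrodinger_solution G (T : R) Psi :=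
  forall t, 0 <= t <= T ->
    exists2 D, has_derivative_on T Psi t D & 'i%C *: D = G t *m Psi t.

Definition is_time_evolution G (T t2 t1 : R) (U : 'M[R[i]]_N) :=
  forall Psi, schrodinger_solution G T Psi -> Psi t2 = U *m Psi t1.

(* The default value is irrelevant for continuous [G] and
   [0 <= t1, t2 <= T], when there is exactly one such matrix. *)
Definition time_evolution G (T t2 t1 : R) : 'M[R[i]]_N :=
  xget 1%:M [set U | is_time_evolution G T t2 t1 U].

End evolution.

(* U_H^gamma for gamma = [segment_path x v] on [[0, T]] *)
Definition line_evolution (R : realType) (n N : nat)
    (H : 'rV[R]_n -> 'M[R[i]]_N) (x v : 'rV[R]_n) (T : R) : 'M[R[i]]_N :=
  time_evolution (fun t => H (segment_path x v t)) T T 0.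

Section amplitudes.
Variables (R : realType) (N : nat).

(* |a^* U b|; the norm of [R[i]] takes its (nonnegative real) values in
   [R[i]] *)
Definition amplitude (a : 'cV[R[i]]_N) (U : 'M[R[i]]_N) (b : 'cV[R[i]]_N) :
    R[i] :=
  `| (a ^t* *m U *m b) ord0 ord0 |.

Definition ideal_data (I F : set 'cV[R[i]]_N) :=
  forall U V : 'M[R[i]]_N, U \is unitarymx -> V \is unitarymx ->
    (forall a b, F a -> I b -> amplitude a U b = amplitude a V b) ->
    exists phi : R, U = (cos phi +i* sin phi)%C *: V.

Definition trace_free_part (A : 'M[R[i]]_N) : 'M[R[i]]_N :=
  A - (N%:R^-1 * \tr A)%:M.

Definition special_unitary : set 'M[R[i]]_N :=
  [set U | U \is unitarymx /\ \det U = 1].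

End amplitudes.

Section xray.
Variables (R : realType) (n m : nat).

Definition complex_integral (T : R) (g : R -> R[i]) : R[i] :=
  (\int[lebesgue_measure]_(t in [set` `[0, T]]) complex.Re (g t)
   +i* \int[lebesgue_measure]_(t in [set` `[0, T]]) complex.Im (g t))%C.

Definition xray_transform (W : 'rV[R]_n * 'rV[R]_n -> 'M[R[i]]_m)
    (f : 'rV[R]_n -> 'cV[R[i]]_m) (x v : 'rV[R]_n) (T : R) : 'cV[R[i]]_m :=
  \col_i complex_integral T (fun t =>
    (W (segment_path x v t, v) *m f (segment_path x v t)) i ord0).

Definition sphere_bundle (Omega : set 'rV[R]_n) :
    set ('rV[R]_n * 'rV[R]_n) :=
  closure Omega `*` @sphere R n.

(* Functions on [closure Omega] are total functions considered only there. *)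
Definition xray_injective (Omega : set 'rV[R]_n)
    (W : 'rV[R]_n * 'rV[R]_n -> 'M[R[i]]_m) :=
  forall f : 'rV[R]_n -> 'cV[R[i]]_m,
    {within closure Omega, continuous f} ->
    (forall x v T, line_through Omega x v T -> xray_transform W f x v T = 0) ->
    forall x, closure Omega x -> f x = 0.

End xray.

(* Main.v *)
(* Both Hamiltonians extend continuously to R^n (Tietze), so the propagators of
   their trace free parts along lines are defined, in SU(N), and jointly
   continuous in the line and the time. The ideal data give U_1 = z U_2 for the
   two propagators along the chord between boundary points p and q, where z is
   an N-th root of unity because both determinants are 1. As U_1 = U_2 for
   q = p, and the boundary is connected for n >= 2, z = 1 on every chord.
   Pseudolinearization then identifies U_1^* U_2 - 1 with the X-ray transform of
   the difference f of the trace free parts, for the weight A |-> P_1^* A P_2 in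
   SU(N^2), where P_k is the propagator of the extended Hamiltonian from the
   foot of the perpendicular from the origin to the line. With the entry point
   of the line as base point the weight need not be continuous on SM unless the
   domain is strictly convex; this is what the extension is for. *)
Require Import Defs.
From HB Require Import structures.
From mathcomp Require Import all_boot all_order all_algebra.
From mathcomp Require Import complex.
From mathcomp Require Import all_classical all_reals all_analysis.
From mathcomp Require Import ring lra.
From mathcomp Require Import perm.
From mathcomp Require mxtens.
Import numFieldNormedType.Exports.
Import Order.TTheory GRing.Theory Num.Theory.
Local Open Scope classical_set_scope.
Local Open Scope ring_scope.
Local Open Scope sesquilinear_scope.

Set Implicit Arguments.
Unset Strict Implicit.
Unset Printing Implicit Defensive.

(** * Linear differential equations with a parameter *)

(** Two continuity requirements shape the proof. The chord propagator must stay continuous where the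
    chord shrinks to a point, although the direction has no limit there. Chords are therefore run in
    unit time with velocity [q - p], and the length enters the generator as a separate factor, so
    that the trivial chord has the identity as propagator. The weight must be continuous on all of
    SM, with base points possibly outside the domain. Both needs are met by one propagator with
    parameters: the linear equation is solved globally in time, with coefficients depending on a
    point of a topological space. Pseudolinearization works from a distant base point because
    propagators compose: if [P_k] leads to the entry point, the product at the exit point is
    [P_1^* U_1^* U_2 P_2], which is its value [P_1^* P_2] at the entry point once [U_1 = U_2]. The
    traces of the Hamiltonians multiply propagators by phases, which amplitudes do not see; this is
    what puts the propagators in SU(N). *)

Section antiderivative.
Context {R : realType}.
Implicit Types f g F G : R -> R.

Lemma is_derive_continuous F (f : R -> R) :
  (forall t : R, is_derive t 1 F (f t)) -> continuous F.
Proof.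
by move=> dF t; apply/differentiable_continuous/derivable1_diffP; have [] := dF t.
Qed.

Lemma is_derive_near_eq F G (t d : R) :
  (\near t, F t = G t) -> is_derive t 1 F d -> is_derive t 1 G d.
Proof.
move=> FG [dF <-]; split; first exact: near_eq_derivable dF.
by rewrite (near_eq_derive _ FG).
Qed.

Lemma is_derive_inc f F (a b : R) : a <= b ->
  (forall t : R, is_derive t 1 F (f t)) -> (forall t, 0 <= f t) -> F a <= F b.
Proof.
move=> ab dF f0.
have cF : {within `[a, b], continuous F}.
  by apply: continuous_subspaceT; exact: is_derive_continuous dF.
have [c _ e] := MVT_segment ab (fun x _ => dF x) cF.
by rewrite -subr_ge0 e mulr_ge0// subr_ge0.
Qed.

(** The fundamental theorem of calculus is available for integrals from a left endpoint to a point
    on its right. To reach all of the real line, the endpoint moves left with [t] and the value at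
    [0] is subtracted; [FD] shows that the result does not depend on the endpoint. *)
Lemma antiderivative g : continuous g ->
  exists2 G, G 0 = 0 & forall t : R, is_derive t 1 G (g t).
Proof.
move=> cg; pose F a t := \int[lebesgue_measure]_(x in `[a, t]) g x.
have ig a b : lebesgue_measure.-integrable `[a, b] (EFin \o g).
  apply: continuous_compact_integrable; first exact: segment_compact.
  exact: continuous_subspaceT.
have dF (a t : R) : a < t -> is_derive t 1 (F a) (g t).
  move=> at_; have t1 : t < t + 1 by rewrite ltrDl.
  have [dFt e] := continuous_FTC1_closed t1 (ig a (t + 1)) at_ (cg t).
  by split; [exact: dFt|rewrite -derive1E].
have FD (a b s t : R) : a < b -> b <= s -> b <= t -> F a t - F a s = F b t - F b s.
  move=> ab; have wl u : b <= u -> F a u - F a b = F b u.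
    move=> bu; rewrite /F Rintegral_itvB ?bnd_simp//; last exact: ltW.
    apply: Rintegral_itv_obnd_cbnd.
    apply: (integrableS _ _ _ (ig b u)) => //.
    by apply: subset_itv; rewrite bnd_simp.
  by move=> /wl <- /wl <-; lra.
pose G t := F (- (`|t| + 1)) t - F (- (`|t| + 1)) 0.
exists G; first by rewrite /G subrr.
(* This [a] lies to the left of [- (|s| + 1)] for every [s] within distance 1 of [t], so one
   endpoint serves near [t]. *)
move=> t; pose a := - (`|t| + 2).
apply: (@is_derive_near_eq (fun s => F a s - F a 0)).
  near=> s; have st : `|t - s| < 1.
    by near: s; apply: (@cvgr_dist_lt _ _ _ _ _ id) => //; exact: cvg_id.
  have := ler_norm (- s); have := ler_norm s.
  have := ler_norm (- t); have := ler_norm t; rewrite !normrN => *.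
  have s0 := normr_ge0 s.
  have : `|s| <= `|t| + `|t - s|.
    by rewrite (le_trans _ (ler_normB t (t - s)))// opprB addrC subrK.
  by rewrite /a /G => ?; apply: FD; lra.
rewrite -[g t]subr0; apply: is_deriveB; apply: dF.
by have := ler_norm (- t); rewrite /a normrN; lra.
Unshelve. all: by end_near. Qed.
End antiderivative.

Section primitive.
Context {R : realType}.
Implicit Types f g F G : R -> R.

(** The signed integral from [0], for times of either sign; the default value is irrelevant for
    continuous [g]. *)
Definition primitive g : R -> R :=
  xget (fun=> 0) [set G | G 0 = 0 /\ forall t : R, is_derive t 1 G (g t)].

Lemma primitiveP g : continuous g ->
  primitive g 0 = 0 /\ forall t : R, is_derive t 1 (primitive g) (g t).
Proof.
move=> /antiderivative[G G0 dG].
by apply: (@xgetPex _ (fun=> 0) [set G | G 0 = 0 /\ forall t, _]); exists G.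
Qed.

(** The mean value theorem for the difference of the primitives; it turns uniform closeness of
    integrands on a symmetric interval into closeness of primitives. *)
Lemma primitiveB_mean f g (t : R) : continuous f -> continuous g ->
  exists2 c, `|c| <= `|t| & primitive f t - primitive g t = (f c - g c) * t.
Proof.
move=> /primitiveP[F0 dF] /primitiveP[G0 dG].
have dH (s : R) : is_derive s 1 (primitive f - primitive g) ((f - g) s).
  exact: is_deriveB.
have cH a b : {within `[a, b], continuous (primitive f - primitive g)}.
  by apply: continuous_subspaceT; exact: is_derive_continuous dH.
have dH' a b (x : R) : x \in `]a, b[ ->
  is_derive x 1 (primitive f - primitive g) ((f - g) x).
  by move=> _; exact: dH.
have [t0|t0] := leP 0 t.
- have [c] := MVT_segment t0 (@dH' _ _) (cH _ _).
  rewrite in_itv/= => /andP[c0 ct]; rewrite !fctE F0 G0 !subr0 => ->.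
  by exists c => //; rewrite !ger0_norm.
- have [c] := MVT_segment (ltW t0) (@dH' _ _) (cH _ _).
  rewrite in_itv/= => /andP[c0 ct]; rewrite !fctE F0 G0 !subrr => e.
  by exists c; [rewrite !ler0_norm ?lerN2// ltW|lra].
Qed.

(* Integration from [0] shrinks this weight by the factor [1 / l], so for large
   [l] Picard iteration contracts globally in time. *)
Definition double_exp (l t : R) : R := expR (l * t) + expR (- l * t).

Lemma double_exp_ge1 l t : 1 <= double_exp l t.
Proof.
rewrite /double_exp; have := expR_ge1Dx (l * t); have := expR_ge1Dx (- l * t).
by rewrite mulNr; lra.
Qed.

Lemma double_exp_continuous l : continuous (double_exp l).
Proof.
move=> t; apply: cvgD; (apply: continuous_comp; last exact: continuous_expR);
  by apply: cvgM; [exact: cvg_cst|exact: cvg_id].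
Qed.

(** The function [w] below is the antiderivative of [M * double_exp l] that vanishes at [0], so
    adding to it or subtracting from it the difference of the primitives gives nondecreasing
    functions. Having both exponentials in the weight handles both signs of [t]. *)
Lemma primitiveB_double_exp f g (M l t : R) : continuous f -> continuous g ->
  0 < l -> 0 <= M -> (forall s, `|f s - g s| <= M * double_exp l s) ->
  `|primitive f t - primitive g t| <= M / l * double_exp l t.
Proof.
move=> /primitiveP[F0 dF] /primitiveP[G0 dG] l0 M0 fg.
pose w (s : R) := M / l * (expR (l * s) - expR (- l * s)).
have dw (s : R) : is_derive s 1 w (M * double_exp l s).
  have de (a : R) : is_derive s 1 (fun u => expR (a * u)) (a * expR (a * s)).
    have da : is_derive s 1 (fun u : R => a * u) a.
      have /= := is_deriveZ a (is_derive_id s (1 : R)).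
      by rewrite /GRing.scale/= mulr1.
    by have := is_derive1_comp (is_derive_expR (a * s)) da; rewrite /comp/= mulrC.
  have := is_deriveZ (M / l) (is_deriveB (de l) (de (- l))).
  by move=> /is_derive_eq; apply; rewrite /GRing.scale/= /double_exp; field; lra.
have fgP s : - (M * double_exp l s) <= f s - g s <= M * double_exp l s.
  by rewrite -ler_norml.
have d1 (s : R) : is_derive s 1 (w - (primitive f - primitive g))
    (M * double_exp l s - (f s - g s)).
  by apply: is_deriveB => //; exact: is_deriveB.
have d2 (s : R) : is_derive s 1 (w + (primitive f - primitive g))
    (M * double_exp l s + (f s - g s)).
  by apply: is_deriveD => //; exact: is_deriveB.
have p1 s : 0 <= M * double_exp l s - (f s - g s) by have := fgP s; lra.
have p2 s : 0 <= M * double_exp l s + (f s - g s) by have := fgP s; lra.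
have w0 : w 0 = 0 by rewrite /w !mulr0 subrr mulr0.
have [t0|/ltW t0] := leP 0 t.
- have := is_derive_inc t0 d1 p1; have := is_derive_inc t0 d2 p2.
  rewrite !fctE w0 F0 G0 ler_norml /double_exp.
  have := mulr_ge0 (divr_ge0 M0 (ltW l0)) (expR_ge0 (- l * t)); rewrite /w; lra.
- have := is_derive_inc t0 d1 p1; have := is_derive_inc t0 d2 p2.
  rewrite !fctE w0 F0 G0 ler_norml /double_exp.
  have := mulr_ge0 (divr_ge0 M0 (ltW l0)) (expR_ge0 (l * t)); rewrite /w; lra.
Qed.

Lemma pair_continuous (X Y Z : topologicalType) (g : X -> Y) (h : X -> Z) :
  continuous g -> continuous h -> continuous (fun x => (g x, h x)).
Proof. move=> cg ch x; exact: (cvg_pair (cg x) (ch x)). Qed.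

Lemma pair_comp_continuous (X Y Z W : topologicalType) (f : Y * Z -> W)
    (g : X -> Y) (h : X -> Z) :
  continuous f -> continuous g -> continuous h -> continuous (fun x =>
    f (g x, h x)).
Proof.
move=> cf cg ch x; apply: (@continuous_comp _ _ _ (fun x => (g x, h x)) f).
  exact: pair_continuous.
exact: cf.
Qed.

Lemma slice_continuous (X : topologicalType) (f : X * R -> R) x :
  continuous f -> continuous (fun s => f (x, s)).
Proof.
by move=> cf; apply: pair_comp_continuous => // s; [exact: cvg_cst|exact: cvg_id].
Qed.

(** The values at [(x0, t0)] and [(x, t)] are compared through [(x0, t)]: the change of time is
    controlled by continuity of one primitive, the change of parameter by closeness of integrands
    uniformly on a compact interval. *)
Lemma primitive_continuous (X : topologicalType) (f : X * R -> R) :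
  continuous f -> continuous (fun p => primitive (fun s => f (p.1, s)) p.2).
Proof.
move=> cf [x0 t0]; apply/cvgrPdist_lt => e e0.
have cs x := @slice_continuous _ _ x cf.
pose L := `|t0| + 1; have L0 : 0 < L by rewrite /L ltr_wpDl.
(* The tube lemma: compactness of [[- L, L]] gives one neighbourhood of [x0] for all times. *)
have tube : \forall x \near x0, `[- L, L] `<=` [set s | `|f (x0, s) - f (x, s)|
  < e / (2 * L)].
  have := @segment_compact _ (- L) L; move/compact_near_coveringP; apply.
  move=> s _.
  have c1 : continuous (fun p : R * X => f (x0, p.1) - f (p.2, p.1)).
    move=> q; apply: (@cvgB _ _ _ _ _ (fun p : R * X => f (x0, p.1)) (fun p =>
      f (p.2, p.1))); move: q.
    - apply: (@pair_comp_continuous _ _ _ _ f (fun=> x0) fst) => // p.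
        exact: cvg_cst.
      exact: cvg_fst.
    - apply: (@pair_comp_continuous _ _ _ _ f snd fst) => // p.
        exact: cvg_snd.
      exact: cvg_fst.
  have := (@cvgr_norm_lt _ _ _ _ _ _ _ (c1 (s, x0))) (e / (2 * L));
    rewrite /= subrr normr0.
  by apply; rewrite divr_gt0// mulr_gt0.
have c2 : \forall t \near t0, `|primitive (fun s => f (x0, s)) t0 -
    primitive (fun s => f (x0, s)) t| < e / 2.
  have [_ dP] := primitiveP (cs x0).
  have cP := is_derive_continuous dP (x := t0).
  by move/cvgrPdist_lt : cP; apply; rewrite divr_gt0.
have c3 : \forall t \near t0, `|t| < L.
  by apply: (@cvgr_norm_lt _ _ _ _ _ id t0 cvg_id); rewrite /L ltrDl.
near=> p.
have h2 : `|p.2| < L by near: p; exact: (cvg_snd (F := nbhs x0) c3).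
have h3 : `|primitive (fun s => f (x0, s)) t0 - primitive (fun s =>
  f (x0, s)) p.2| < e / 2.
  by near: p; exact: (cvg_snd (F := nbhs x0) c2).
have h1 : `[- L, L] `<=` [set s | `|f (x0, s) - f (p.1, s)| < e / (2 * L)].
  by near: p; exact: (cvg_fst (G := nbhs t0) tube).
have [c cp] := primitiveB_mean p.2 (cs x0) (cs p.1).
have := h1 c; rewrite /= in_itv/= -ler_norml (le_trans cp (ltW h2)) =>
  /(_ isT) h4 e1.
rewrite (le_lt_trans (ler_distD (primitive (fun s => f (x0, s)) p.2) _ _))//.
rewrite [ltRHS]splitr ltr_leD// e1 normrM.
have -> : e / 2 = e / (2 * L) * L by field; lra.
by apply: ler_pM => //; apply: ltW.
Unshelve. all: by end_near. Qed.
End primitive.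

(** * Global Picard iteration for linear systems with a parameter *)

Section linear_ode.
Context {R : realType} (X : topologicalType) (T : finType).
Variables (K : T -> T -> X * R -> R) (C : R) (y0 : T -> R).
Hypothesis Kcont : forall i j, continuous (K i j).
Hypothesis Kbound : forall i j p, `|K i j p| <= C.
Hypothesis C_ge0 : 0 <= C.

Let rhs (y : T -> X * R -> R) i p := \sum_j K i j p * y j p.

Let rhs_continuous y i : (forall j, continuous (y j)) -> continuous (rhs y i).
Proof.
move=> cy p; rewrite /rhs; apply: cvg_big => [|j _]; first exact: add_continuous.
by apply: cvgM; [exact: Kcont|exact: cy].
Qed.

Fixpoint picard n i : X * R -> R :=
  if n is m.+1 then
    fun p => y0 i + primitive (fun s => rhs (picard m) i (p.1, s)) p.2
  else fun=> 0.

Let picard_continuous n i : continuous (picard n i).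
Proof.
elim: n i => [|n IH] i p /=; first exact: cvg_cst.
apply: cvgD; first exact: cvg_cst.
exact: (@primitive_continuous _ _ (rhs (picard n) i) (rhs_continuous IH)).
Qed.

(** The right-hand side has Lipschitz constant at most [#|T| * C] in the maximum over the
    components, and integration gains [1 / l]; hence each Picard step contracts by at least one
    half. The [+ 1] keeps [l] positive. *)
Let l : R := 2 * (#|T|%:R * C + 1).
Let w (p : X * R) : R := double_exp l p.2.
Let B : R := \sum_i `|y0 i|.

Let l_gt0 : 0 < l.
Proof. by rewrite /l mulr_gt0// ltr_wpDl// mulr_ge0. Qed.

Let w_ge0 p : 0 <= w p.
Proof. exact: le_trans (double_exp_ge1 _ _). Qed.

Let B_ge0 : 0 <= B. Proof. exact: sumr_ge0. Qed.

Let picard_rhs_bound (y z : T -> X * R -> R) (M : R) i (p : X * R) : 0 <= M ->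
  (forall j, continuous (y j)) -> (forall j, continuous (z j)) ->
  (forall j q, `|y j q - z j q| <= M * w q) ->
  `|primitive (fun s => rhs y i (p.1, s)) p.2
    - primitive (fun s => rhs z i (p.1, s)) p.2| <= M / 2 * w p.
Proof.
move=> M0 cy cz yz.
have := @primitiveB_double_exp _ (fun s => rhs y i (p.1, s))
  (fun s => rhs z i (p.1, s)) (#|T|%:R * C * M) l p.2.
move=> /(_ _ _ l_gt0) h; apply: (le_trans (h _ _ _ _)).
- exact/slice_continuous/rhs_continuous.
- exact/slice_continuous/rhs_continuous.
- by rewrite !mulr_ge0.
- move=> s; rewrite /rhs -sumrB (le_trans (ler_norm_sum _ _ _))//.
  apply: (@le_trans _ _ (\sum_(j : T) C * (M * double_exp l s))).
    apply: ler_sum => j _; rewrite -mulrBr normrM; apply: ler_pM => //.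
  by rewrite sumr_const -[_ *+ #|_|]mulr_natl !mulrA.
- apply: ler_wpM2r; first exact: w_ge0.
  rewrite ler_pdivrMr// /l.
  have : 0 <= #|T|%:R * C * M by rewrite !mulr_ge0.
  lra.
Qed.

Let picard_step n i p : `|picard n.+1 i p - picard n i p| <= B / 2 ^+ n * w p.
Proof.
elim: n i p => [|n IH] i p.
  rewrite /= subr0 expr0 divr1.
  have -> : primitive (fun s => rhs (fun _ _ => 0) i (p.1, s)) p.2 = 0.
    have -> : (fun s => rhs (fun _ _ => 0) i (p.1, s)) = fun=> 0.
      by apply/funext => s; rewrite /rhs big1// => j _; rewrite mulr0.
    have [P0 dP] := primitiveP (@cst_continuous R R 0).
    by rewrite (is_derive_0_is_cst p.2 0 dP).
  rewrite addr0 -[leLHS]mulr1; apply: ler_pM => //; last exact: double_exp_ge1.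
  by rewrite /B (bigD1 i)//= lerDl sumr_ge0.
have -> : picard n.+2 i p - picard n.+1 i p =
    primitive (fun s => rhs (picard n.+1) i (p.1, s)) p.2
    - primitive (fun s => rhs (picard n) i (p.1, s)) p.2.
  by rewrite /= opprD addrACA subrr add0r.
have := @picard_rhs_bound (picard n.+1) (picard n) (B / 2 ^+ n) i p.
rewrite exprS invfM mulrCA mulrA [_ / 2]mulrC mulrA; apply => //.
by rewrite divr_ge0// exprn_ge0.
Qed.

Let picard_tail n k i p :
  `|picard (n + k) i p - picard n i p| <= 2 * B / 2 ^+ n * w p.
Proof.
(* The induction on [k] needs the exact partial sum of the geometric series; the stated bound drops
   its negative term. *)
suff : `|picard (n + k) i p - picard n i p| <=
    2 * B * ((2 ^+ n)^-1 - (2 ^+ (n + k))^-1) * w p.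
  move=> /le_trans; apply; apply: ler_wpM2r => //; apply: ler_wpM2l.
    by rewrite mulr_ge0.
  by rewrite lerBlDr lerDl invr_ge0 exprn_ge0.
elim: k => [|k IH]; first by rewrite addn0 !subrr normr0 mulr0 mul0r.
rewrite addnS (le_trans (ler_distD (picard (n + k) i p) _ _))//.
apply: le_trans (lerD (picard_step _ _ _) IH) _.
rewrite -mulrDl; apply: ler_wpM2r => //; rewrite exprS invfM.
by rewrite le_eqVlt; apply/orP; left; apply/eqP; set a := (_ ^+ (n + k))^-1;
  set b := (_ ^+ n)^-1; field.
Qed.

Let half_pow_lt (M e : R) : 0 <= M -> 0 < e -> exists n, M / 2 ^+ n < e.
Proof.
move=> M0 e0; have := @cvg_geometric R M 2^-1.
rewrite ger0_norm// => /(_ _)/cvgrPdist_lt.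
have -> : 2^-1 < 1 :> R by lra.
move=> /(_ isT e e0)[n _ /(_ n (leqnn n))]; rewrite sub0r normrN => h.
exists n; rewrite -exprVn; apply: le_lt_trans h.
by rewrite /geometric/=; exact: ler_norm.
Qed.

Let y i p : R := lim (picard n i p @[n --> \oo]).

Let y_cvg i p : picard n i p @[n --> \oo] --> y i p.
Proof.
apply: cauchy_cvg; apply/cauchy_exP => e e0.
have [n hn] := @half_pow_lt (2 * B * w p) e (mulr_ge0 (mulr_ge0 (ler0n R 2)
  B_ge0) (w_ge0 p)) e0.
exists (picard n i p); exists n => // m /= nm.
rewrite -ball_normE /= distrC -(subnKC nm); apply: le_lt_trans hn.
by rewrite (le_trans (picard_tail _ _ _ _))// mulrAC.
Qed.

Let y_tail n i p : `|y i p - picard n i p| <= 2 * B / 2 ^+ n * w p.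
Proof.
have c : `|picard m i p - picard n i p| @[m --> \oo] --> `|y i p - picard n i p|.
  by apply: cvg_norm; apply: cvgB; [exact: y_cvg|exact: cvg_cst].
apply: (cvgr_to_le c); exists n => // m /= nm.
by rewrite -(subnKC nm) picard_tail.
Qed.

(** Convergence is uniform only relative to the unbounded weight [w]. Near [p] the weight stays
    below [w p + 1], which is enough for an argument with three thirds of [e]. *)
Let y_continuous i : continuous (y i).
Proof.
move=> p; apply/cvgrPdist_lt => e e0.
have e3 : 0 < e / 3 by lra.
have [n hn] := @half_pow_lt (2 * B * (w p + 1)) (e / 3)
  (mulr_ge0 (mulr_ge0 (ler0n R 2) B_ge0) (addr_ge0 (w_ge0 p) ler01)) e3.
have cw : w q @[q --> p] --> w p.
  apply: (@continuous_comp _ _ _ snd (double_exp l)); first exact: cvg_snd.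
  exact: double_exp_continuous.
have b q : w q <= w p + 1 -> `|y i q - picard n i q| < e / 3.
  move=> wq; apply: le_lt_trans hn; apply: le_trans (y_tail _ _ _) _.
  rewrite mulrAC; apply: ler_wpM2r; first by rewrite invr_ge0 exprn_ge0.
  by apply: ler_wpM2l => //; rewrite mulr_ge0.
near=> q.
have h1 : `|y i p - picard n i p| < e / 3 by apply: b; rewrite lerDl.
have h2 : `|y i q - picard n i q| < e / 3.
  apply: b; apply: ltW; near: q.
  by apply: (cvgr_lt _ cw); rewrite ltrDl.
have h3 : `|picard n i p - picard n i q| < e / 3.
  by near: q; move/cvgrPdist_lt : (@picard_continuous n i p); exact.
move: h1 h2 h3; rewrite !ltr_norml => /andP[? ?] /andP[? ?] /andP[? ?].
by apply/andP; split; lra.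
Unshelve. all: by end_near. Qed.

(** Both sides are within [e / 2] of the same Picard iterate, the right one by the contraction
    estimate, so no limit is interchanged with an integral. *)
Let y_integral i p :
  y i p = y0 i + primitive (fun s => rhs y i (p.1, s)) p.2.
Proof.
apply/eqP; rewrite -subr_eq0 -normr_le0; apply/ler_addgt0Pl => e e0.
rewrite addr0.
have e2 : 0 < e / 2 by lra.
have [n hn] := @half_pow_lt (2 * B * w p) (e / 2)
  (mulr_ge0 (mulr_ge0 (ler0n R 2) B_ge0) (w_ge0 p)) e2.
have h1 := @y_tail n.+1 i p.
have h2 : `|primitive (fun s => rhs y i (p.1, s)) p.2
    - primitive (fun s => rhs (picard n) i (p.1, s)) p.2|
    <= (2 * B / 2 ^+ n) / 2 * w p.
  apply: picard_rhs_bound => //.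
  by rewrite divr_ge0// ?exprn_ge0// mulr_ge0.
have h3 : 2 * B / 2 ^+ n.+1 * w p <= 2 * B * w p / 2 ^+ n.
  rewrite mulrAC; apply: ler_wpM2l; first by rewrite !mulr_ge0.
  by rewrite exprS invfM ler_piMl ?invr_ge0 ?exprn_ge0//; lra.
have h4 : 2 * B / 2 ^+ n / 2 * w p <= 2 * B * w p / 2 ^+ n.
  rewrite [leLHS]mulrAC (mulrAC (2 * B)) ler_piMr//; last by lra.
  by rewrite mulr_ge0 ?invr_ge0 ?exprn_ge0 ?mulr_ge0.
move: h1 h2 => /= h1 h2.
have := le_trans h1 h3; have := le_trans h2 h4.
by rewrite !ler_norml => /andP[? ?] /andP[? ?]; apply/andP; split; lra.
Qed.

Lemma linear_ode : exists y : T -> X * R -> R,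
  [/\ forall i, continuous (y i), forall i x, y i (x, 0) = y0 i &
      forall i x (t : R), is_derive t 1 (fun s => y i (x, s))
        (\sum_j K i j (x, t) * y j (x, t))].
Proof.
have P i x := @primitiveP _ (fun s => rhs y i (x, s))
  (slice_continuous (rhs_continuous y_continuous)).
exists y; split => // [i x|i x t].
  by rewrite y_integral /= (P i x).1 addr0.
have := is_deriveD (is_derive_cst (y0 i) t 1) ((P i x).2 t).
rewrite add0r; congr (is_derive _ _ _ _).
by apply/funext => s; rewrite y_integral.
Qed.

End linear_ode.

(** * Calculus of complex matrices depending on a real variable *)

Section complex_topology_facts.
Context {R : realType}.
Implicit Types z w : R[i].

Lemma ReD z w : complex.Re (z + w) = complex.Re z + complex.Re w.
Proof. by case: z; case: w. Qed.

Lemma ImD z w : complex.Im (z + w) = complex.Im z + complex.Im w.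
Proof. by case: z; case: w. Qed.

Lemma ReM z w : complex.Re (z * w) =
  complex.Re z * complex.Re w - complex.Im z * complex.Im w.
Proof. by case: z; case: w. Qed.

Lemma ImM z w : complex.Im (z * w) =
  complex.Re z * complex.Im w + complex.Im z * complex.Re w.
Proof. by case: z => a b; case: w. Qed.

Lemma Re_conj z : complex.Re (Num.conj z) = complex.Re z.
Proof. by case: z. Qed.

Lemma Im_conj z : complex.Im (Num.conj z) = - complex.Im z.
Proof. by case: z. Qed.

Lemma complex_ext z w :
  complex.Re z = complex.Re w -> complex.Im z = complex.Im w -> z = w.
Proof. by case: z => a b; case: w => c d /= -> ->. Qed.

Lemma normc_le_ReIm z : `|z| <= (`|complex.Re z| + `|complex.Im z|)%:C%C.
Proof.
rewrite normc_def lecR -(@ler_pXn2r _ 2) ?nnegrE ?addr_ge0 ?sqrtr_ge0//.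
rewrite sqr_sqrtr ?addr_ge0 ?sqr_ge0// sqrrD !real_normK ?num_real//.
by rewrite addrAC lerDl mulrn_wge0// mulr_ge0.
Qed.

Lemma Re_le_normc z : `|complex.Re z|%:C%C <= `|z|.
Proof. exact: normc_ge_Re. Qed.

Lemma Im_le_normc z : `|complex.Im z|%:C%C <= `|z|.
Proof.
rewrite normc_def lecR -(@ler_pXn2r _ 2) ?nnegrE ?sqrtr_ge0//.
by rewrite sqr_sqrtr ?addr_ge0 ?sqr_ge0// real_normK ?num_real// lerDr sqr_ge0.
Qed.

Lemma Re_continuous : continuous (@complex.Re R : R[i] -> R).
Proof.
move=> z; have F : Filter (nbhs z) by exact: nbhs_filter.
apply/(@cvgrPdist_lt _ _ _ _ F) => e e0; apply/nbhs_ballP.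
exists e%:C%C => [|w]; first by rewrite /= ltcR.
rewrite -ball_normE /= => h; rewrite -ltcR; apply: le_lt_trans h.
by have := Re_le_normc (z - w); case: (z) => ? ?; case: (w).
Qed.

Lemma Im_continuous : continuous (@complex.Im R : R[i] -> R).
Proof.
move=> z; have F : Filter (nbhs z) by exact: nbhs_filter.
apply/(@cvgrPdist_lt _ _ _ _ F) => e e0; apply/nbhs_ballP.
exists e%:C%C => [|w]; first by rewrite /= ltcR.
rewrite -ball_normE /= => h; rewrite -ltcR; apply: le_lt_trans h.
by have := Im_le_normc (z - w); case: (z) => ? ?; case: (w).
Qed.

Lemma cvg_complex (T : Type) (F : set_system T) (f : T -> R[i]) (l : R[i]) :
  Filter F -> complex.Re (f x) @[x --> F] --> complex.Re l ->
  complex.Im (f x) @[x --> F] --> complex.Im l -> f x @[x --> F] --> l.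
Proof.
move=> FF cRe cIm; apply/(@cvgrPdist_lt _ _ _ _ FF) => e e0.
have [e1 e2] : 0 < complex.Re e /\ e = (complex.Re e)%:C%C.
  by move: e0; rewrite ltcE /= => /andP[/eqP h ?]; split => //; apply: complex_ext.
have e3 : 0 < complex.Re e / 2 by lra.
move/cvgrPdist_lt : cRe => /(_ _ e3) cRe; move/cvgrPdist_lt : cIm => /(_ _ e3) cIm.
near=> x; apply: le_lt_trans (normc_le_ReIm _) _; rewrite e2 ltcR [ltRHS]splitr.
have h1 : `|complex.Re l - complex.Re (f x)| < complex.Re e / 2 by near: x.
have h2 : `|complex.Im l - complex.Im (f x)| < complex.Re e / 2 by near: x.
by apply: ltrD; [move: h1|move: h2]; case: (l) => ? ?; case: (f x).
Unshelve. all: by end_near. Qed.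

Lemma continuous_complex (X : topologicalType) (f : X -> R[i]) :
  continuous f <-> continuous (fun x => complex.Re (f x)) /\
                   continuous (fun x => complex.Im (f x)).
Proof.
split=> [cf|[cRe cIm] x]; last by apply: cvg_complex; [exact: cRe|exact: cIm].
split=> x; (apply: continuous_comp; first exact: cf).
- exact: Re_continuous.
- exact: Im_continuous.
Qed.

Lemma cvg_mx (X : Type) (T : topologicalType) m n (F : set_system X)
    (f : X -> 'M[T]_(m, n)) (M : 'M[T]_(m, n)) : Filter F ->
  f x @[x --> F] --> M <-> forall i j, f x i j @[x --> F] --> M i j.
Proof.
move=> FF; split=> [cf i j A fA|cf A [P fP PA]].
- apply: (cf [set M | A (M i j)]).
  exists (fun i' j' => if (i' == i) && (j' == j) then A else setT).
    by move=> i' j'; case: ifP => [/andP[/eqP -> /eqP ->]//|_]; exact: filterT.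
  by move=> N /(_ i j); rewrite !eqxx.
- apply: (@filterS _ F _ [set y | forall i j, P i j (f y i j)]) => [y h|].
    by apply: PA => i j; exact: h.
  have hi i : \near F, forall j, P i j (f F i j).
    apply: (@filter_forall _ _ (fun j => [set y | P i j (f y i j)]) F) => j.
    exact: cf (fP i j).
  exact: (@filter_forall _ _ (fun i => [set y | forall j, P i j (f y i j)]) F _ hi).
Qed.

Lemma continuous_mx (X T : topologicalType) m n (f : X -> 'M[T]_(m, n)) :
  continuous f <-> forall i j, continuous (fun x => f x i j).
Proof.
split=> [cf i j x|cf x]; first by move/cvg_mx : (cf x) => /(_ i j).
by apply/cvg_mx => i j; exact: cf.
Qed.

End complex_topology_facts.

Section complex_derivative.
Context {R : realType}.
Implicit Types (f g : R -> R[i]) (c d z w : R[i]) (t : R).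

(** Stated by components because the variable is real, while [R[i]] is normed as a module over
    itself. *)
Definition cderive f t d :=
  is_derive t 1 (fun s => complex.Re (f s)) (complex.Re d) /\
  is_derive t 1 (fun s => complex.Im (f s)) (complex.Im d).

Lemma cderive_eq f g t c d : cderive f t c -> f =1 g -> c = d -> cderive g t d.
Proof. by move=> df /funext <- <-. Qed.

Lemma cderive_cst z t : cderive (fun=> z) t 0.
Proof. by split; exact: is_derive_cst. Qed.

Lemma cderiveD f g t c d : cderive f t c -> cderive g t d ->
  cderive (fun s => f s + g s) t (c + d).
Proof.
move=> [f1 f2] [g1 g2]; split.
- under eq_fun do rewrite ReD; rewrite ReD; exact: is_deriveD.
- under eq_fun do rewrite ImD; rewrite ImD; exact: is_deriveD.
Qed.

Lemma cderiveM f g t c d : cderive f t c -> cderive g t d ->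
  cderive (fun s => f s * g s) t (c * g t + f t * d).
Proof.
move=> [f1 f2] [g1 g2]; split.
- under eq_fun do rewrite ReM; rewrite ReD !ReM.
  have := is_deriveB (is_deriveM f1 g1) (is_deriveM f2 g2); move/is_derive_eq;
    apply.
  by rewrite /GRing.scale/=; ring.
- under eq_fun do rewrite ImM; rewrite ImD !ImM.
  have := is_deriveD (is_deriveM f1 g2) (is_deriveM f2 g1); move/is_derive_eq;
    apply.
  by rewrite /GRing.scale/=; ring.
Qed.

Lemma cderiveZ z g t d : cderive g t d -> cderive (fun s => z * g s) t (z * d).
Proof.
move=> dg; apply: cderive_eq (cderiveM (cderive_cst z t) dg) _ _ => //.
by rewrite mul0r add0r.
Qed.

Lemma cderive_conj f t c : cderive f t c ->
  cderive (fun s => Num.conj (f s)) t (Num.conj c).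
Proof.
move=> [f1 f2]; split.
- by under eq_fun do rewrite Re_conj; rewrite Re_conj.
- by under eq_fun do rewrite Im_conj; rewrite Im_conj; exact: is_deriveN.
Qed.

Lemma cderive_sum (I : Type) (r : seq I) (P : pred I) (f : I -> R ->
  R[i]) (c : I -> R[i]) t :
  (forall i, P i -> cderive (f i) t (c i)) ->
  cderive (fun s => \sum_(i <- r | P i) f i s) t (\sum_(i <- r | P i) c i).
Proof.
move=> df; elim: r => [|i r IH].
  by apply: cderive_eq (cderive_cst 0 t) _ _ => [s|]; rewrite big_nil.
have [Pi|Pi] := boolP (P i).
  by apply: cderive_eq (cderiveD (df i Pi) IH) _ _ => [s|]; rewrite big_cons Pi.
by apply: cderive_eq IH _ _ => [s|]; rewrite big_cons (negbTE Pi).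
Qed.

Lemma cderive_prod (I : finType) (f : I -> R -> R[i]) (c : I -> R[i]) t :
  (forall i, cderive (f i) t (c i)) ->
  cderive (fun s => \prod_i f i s) t (\sum_i c i * \prod_(k | k != i) f k t).
Proof.
move=> df; suff : forall r, uniq r ->
    cderive (fun s => \prod_(i <- r) f i s) t
      (\sum_(i <- r) c i * \prod_(k <- r | k != i) f k t).
  by apply; exact: index_enum_uniq.
elim=> [_|a r IH /= /andP[ar ur]].
  by apply: cderive_eq (cderive_cst 1 t) _ _ => [s|]; rewrite big_nil.
apply: cderive_eq (cderiveM (df a) (IH ur)) _ _ => [s|]; rewrite big_cons//.
rewrite big_cons eqxx/=; congr (_ * _ + _).
  rewrite big_seq_cond [RHS]big_seq_cond; apply: eq_bigl => i /=.
  by rewrite andbT; case: (boolP (i \in r)) => //= ir; case: eqP ir ar => // -> ->.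
rewrite mulr_sumr [LHS]big_seq [RHS]big_seq; apply: eq_bigr => i ir.
rewrite big_cons; case: eqP ir ar => [-> ->//|_ _ _].
by rewrite mulrCA.
Qed.

Lemma cderive0_cst f : (forall t, cderive f t 0) -> forall s t, f s = f t.
Proof.
move=> df s t; apply: complex_ext.
- exact: (is_derive_0_is_cst (f := fun s => complex.Re (f s))) (fun t => (df t).1).
- exact: (is_derive_0_is_cst (f := fun s => complex.Im (f s))) (fun t => (df t).2).
Qed.

Lemma cderive_comp_affine f (a b : R) t c : cderive f (a * t + b) c ->
  cderive (fun s => f (a * s + b)) t (a%:C%C * c).
Proof.
have da : is_derive t 1 (fun s : R => a * s + b) a.
  have := is_deriveD (is_deriveZ a (is_derive_id t (1 : R))) (is_derive_cst b t 1).
  move/is_derive_eq; apply.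
  by rewrite /GRing.scale/= mulr1 addr0.
move=> [f1 f2]; split.
- rewrite ReM /= mul0r subr0 mulrC.
  exact: (@is_derive1_comp _ _ (fun s => a * s + b) t _ _ f1 da).
- rewrite ImM /= mul0r addr0 mulrC.
  exact: (@is_derive1_comp _ _ (fun s => a * s + b) t _ _ f2 da).
Qed.

Definition mderive m n (A : R -> 'M[R[i]]_(m, n)) t (D : 'M[R[i]]_(m, n)) :=
  forall i j, cderive (fun s => A s i j) t (D i j).

Lemma mderive_eq m n (A B : R -> 'M[R[i]]_(m, n)) t C D :
  mderive A t C -> A =1 B -> C = D -> mderive B t D.
Proof. by move=> dA /funext <- <-. Qed.

Lemma mderive_mul m n p (A : R -> 'M[R[i]]_(m, n)) (B : R ->
  'M[R[i]]_(n, p)) t C D :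
  mderive A t C -> mderive B t D ->
  mderive (fun s => A s *m B s) t (C *m B t + A t *m D).
Proof.
move=> dA dB i j.
apply: cderive_eq (cderive_sum (index_enum _) (P := predT)
  (fun k _ => cderiveM (dA i k) (dB k j))) _ _ => [s|].
  by rewrite mxE.
by rewrite big_split !mxE.
Qed.

Lemma mderive_cst m n (A : 'M[R[i]]_(m, n)) t : mderive (fun=> A) t 0.
Proof. by move=> i j; rewrite mxE; exact: cderive_cst. Qed.

Lemma mderive_adj m n (A : R -> 'M[R[i]]_(m, n)) t C :
  mderive A t C -> mderive (fun s => (A s)^t*) t (C^t*).
Proof.
move=> dA i j; apply: cderive_eq (cderive_conj (dA j i)) _ _ => [s|];
  by rewrite !mxE.
Qed.

Lemma mderive0_cst m n (A : R -> 'M[R[i]]_(m, n)) :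
  (forall t, mderive A t 0) -> forall s t, A s = A t.
Proof.
move=> dA s t; apply/matrixP => i j.
by apply: (@cderive0_cst (fun s => A s i j)) => u; have := dA u i j; rewrite mxE.
Qed.

(** Jacobi's formula, obtained by differentiating the Leibniz expansion one row at a time. *)
Lemma mderive_det n (A : R -> 'M[R[i]]_n) t D :
  mderive A t D -> cderive (fun s => \det (A s)) t (\tr (D *m \adj (A t))).
Proof.
move=> dA.
have dprod (s : 'S_n) : cderive (fun u => (-1) ^+ s * \prod_i A u i (s i)) t
    ((-1) ^+ s * \sum_i D i (s i) * \prod_(k | k != i) A t k (s k)).
  by apply: cderiveZ; apply: cderive_prod => i; exact: dA.
apply: cderive_eq (cderive_sum (index_enum _) (P := predT) (fun s _ =>
  dprod s)) _ _ => //.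
under eq_bigr do rewrite mulr_sumr.
rewrite exchange_big; apply: eq_bigr => i _ /=.
(* [B] is [A t] with row [i] taken from [D]: its determinant collects the terms in which the factor
   from row [i] is differentiated, and expansion along that row produces the adjugate. *)
pose B := \matrix_(k, j) (if k == i then D i j else A t k j).
transitivity (\det B).
  apply: eq_bigr => s _; congr (_ * _); rewrite [RHS](bigD1 i)//= !mxE eqxx.
  by congr (_ * _); apply: eq_bigr => k /negbTE ki; rewrite !mxE ki.
rewrite (expand_det_row _ i) mxE; apply: eq_bigr => j _; rewrite !mxE eqxx.
congr (_ * (_ * \det _)); apply/matrixP => k l; rewrite !mxE.
by rewrite eq_sym (negbTE (neq_lift _ _)).
Qed.

End complex_derivative.

(** * The Schrodinger equation *)

Section propagator.
Context {R : realType}.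

Lemma continuous_entry (X : topologicalType) m n (f : X -> 'M[R[i]]_(m, n)) i j :
  continuous f -> continuous (fun x => f x i j).
Proof. by move=> /continuous_mx. Qed.

Lemma Re_sum (I : Type) (r : seq I) (P : pred I) (F : I -> R[i]) :
  complex.Re (\sum_(i <- r | P i) F i) = \sum_(i <- r | P i) complex.Re (F i).
Proof. by apply: (big_morph _ ReD). Qed.

Lemma Im_sum (I : Type) (r : seq I) (P : pred I) (F : I -> R[i]) :
  complex.Im (\sum_(i <- r | P i) F i) = \sum_(i <- r | P i) complex.Im (F i).
Proof. by apply: (big_morph _ ImD). Qed.

Lemma sum_prod_bool (I : finType) (F : I * bool -> R) :
  \sum_p F p = \sum_i (F (i, true) + F (i, false)).
Proof.
transitivity (\sum_p F (p.1, p.2)); first by apply: eq_bigr => -[].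
by rewrite -(pair_bigA _ (fun i b => F (i, b))); apply: eq_bigr => i _;
  rewrite big_bool.
Qed.

Definition schrodinger_flow n (G Phi : R -> 'M[R[i]]_n) :=
  forall t, mderive Phi t (- 'i%C *: (G t *m Phi t)).

(** Each column solves a real system of twice the size, indexed by ['I_n * bool] with [true] for
    imaginary parts, starting from a unit vector. *)
Lemma propagator (X : topologicalType) n (G : X * R -> 'M[R[i]]_n) (C : R) :
  continuous G -> 0 <= C -> (forall p i j, `|G p i j| <= C%:C%C) ->
  exists Phi : X * R -> 'M[R[i]]_n,
    [/\ continuous Phi, forall x, Phi (x, 0) = 1%:M &
        forall x, schrodinger_flow (fun t => G (x, t)) (fun t => Phi (x, t))].
Proof.
move=> cG C0 bG.
(* Multiplication by [-i G] in real coordinates: the real part of [-i z] is [Im z], and its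
   imaginary part is [- Re z]. *)
pose K (a b : 'I_n * bool) (p : X * R) : R :=
  if a.2 == b.2 then complex.Im (G p a.1 b.1)
  else if a.2 then - complex.Re (G p a.1 b.1) else complex.Re (G p a.1 b.1).
have cK a b : continuous (K a b).
  have [cRe cIm] := (continuous_complex _).1 (continuous_entry (i := a.1) (j :=
    b.1) cG).
  rewrite /K; case: eqP => _; first exact: cIm.
  by case: a.2; [move=> p; apply: cvgN; exact: cRe|exact: cRe].
have bK a b p : `|K a b p| <= C.
  rewrite /K -lecR; apply: le_trans (bG p a.1 b.1).
  case: eqP => _; first exact: Im_le_normc.
  by case: a.2; rewrite ?normrN; exact: Re_le_normc.
pose y0 (k : 'I_n) (a : 'I_n * bool) : R := if a.2 then 0 else (a.1 == k)%:R.
have /choice[y hy] : forall k : 'I_n, exists y : 'I_n * bool -> X * R -> R,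
  [/\ forall i, continuous (y i), forall i x, y i (x, 0) = y0 k i &
      forall i x (t : R), is_derive t 1 (fun s => y i (x, s))
        (\sum_j K i j (x, t) * y j (x, t))].
  by move=> k; exact: linear_ode bK C0.
exists (fun p => \matrix_(i, k) (y k (i, false) p +i* y k (i, true) p)%C); split.
- apply/continuous_mx => i k; apply/continuous_complex.
  under [in X in X /\ _]eq_fun do rewrite mxE.
  under [in X in _ /\ X]eq_fun do rewrite mxE.
  by have [cy _ _] := hy k; split; exact: cy.
- move=> x; apply/matrixP => i k; rewrite !mxE.
  have [_ -> _] := hy k; have [_ -> _] := hy k; rewrite /y0/=.
  by case: eqP.
- move=> x t i k; have [_ _ dy] := hy k.
  split; under eq_fun do rewrite mxE; rewrite /=.
  + have := dy (i, false) x t; move/is_derive_eq; apply.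
    by rewrite !mxE mulr_sumr Re_sum sum_prod_bool; apply: eq_bigr => l _;
      rewrite /K !mxE/= !(ReM, ImM)/= ?(ReM, ImM)/=; ring.
  + have := dy (i, true) x t; move/is_derive_eq; apply.
    by rewrite !mxE mulr_sumr Im_sum sum_prod_bool; apply: eq_bigr => l _;
      rewrite /K !mxE/= !(ReM, ImM)/= ?(ReM, ImM)/=; ring.
Qed.

Lemma adj_iM_hermitian n m (G : 'M[R[i]]_n) (P : 'M[R[i]]_(n, m)) :
  G \is hermsymmx -> (- 'i%C *: (G *m P))^t* = 'i%C *: (P^t* *m G).
Proof.
move=> /is_hermitianmxP; rewrite expr0 scale1r => hG.
rewrite [in RHS]hG -map_mxM -trmx_mul; apply/matrixP => i j; rewrite !mxE rmorphM.
by congr (_ * _); apply: complex_ext; rewrite /= ?opprK ?oppr0.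
Qed.

(** The identity behind pseudolinearization. For equal generators the derivative vanishes, which
    yields unitarity and uniqueness; for different ones it is the integrand of the X-ray
    transform. *)
Lemma schrodinger_flow_adj_mul n (G1 G2 Phi1 Phi2 : R -> 'M[R[i]]_n) t :
  schrodinger_flow G1 Phi1 -> schrodinger_flow G2 Phi2 ->
  G1 t \is hermsymmx ->
  mderive (fun s => (Phi1 s)^t* *m Phi2 s) t
    ('i%C *: ((Phi1 t)^t* *m (G1 t - G2 t) *m Phi2 t)).
Proof.
move=> d1 d2 hG.
apply: mderive_eq (mderive_mul (mderive_adj (d1 t)) (d2 t)) _ _ => //.
rewrite adj_iM_hermitian//.
rewrite -scalemxAl -scalemxAr scaleNr -scalerBr; congr (_ *: _).
by rewrite mulmxBr mulmxBl !mulmxA.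
Qed.

Lemma schrodinger_flow_unitary n (G Phi : R -> 'M[R[i]]_n) :
  schrodinger_flow G Phi -> Phi 0 = 1%:M -> (forall t, G t \is hermsymmx) ->
  forall t, Phi t \is unitarymx.
Proof.
move=> dPhi P0 hG t; have h : (Phi t)^t* *m Phi t = 1%:M.
  rewrite (@mderive0_cst _ _ _ (fun s => (Phi s)^t* *m Phi s) _ t 0).
    by rewrite P0 trmx1 map_mx1 mulmx1.
  move=> s; apply: mderive_eq (schrodinger_flow_adj_mul dPhi dPhi (hG s)) _ _ => //.
  by rewrite subrr mulmx0 mul0mx scaler0.
by apply/unitarymxP; exact: mulmx1C.
Qed.

(** By Jacobi's formula the derivative of the determinant is [-i tr(G) det(Phi)], which is zero. *)
Lemma schrodinger_flow_det n (G Phi : R -> 'M[R[i]]_n) :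
  schrodinger_flow G Phi -> Phi 0 = 1%:M -> (forall t, \tr (G t) = 0) ->
  forall t, \det (Phi t) = 1.
Proof.
move=> dPhi P0 trG t; rewrite (@cderive0_cst _ (fun s => \det (Phi s)) _ t 0).
  by rewrite P0 det1.
move=> s; apply: cderive_eq (mderive_det (dPhi s)) _ _ => //.
by rewrite -scalemxAl mxtraceZ -mulmxA mul_mx_adj mul_mx_scalar mxtraceZ trG !mulr0.
Qed.

End propagator.

(** * Difference quotients relative to a closed interval *)

Section one_sided_derivatives.
Context {R : realType}.
Implicit Types (f : R -> R) (t d T : R) (A : set R).

Lemma is_derive_quotient A f t d : is_derive t 1 f d ->
  (s - t)^-1 * (f s - f t) @[s --> within A t^'] --> d.
Proof.
move=> /is_derive1_caratheodory[g [fg cg <-]].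
have h : g s @[s --> within A t^'] --> g t.
  apply: cvg_trans cg; apply: cvg_app; apply: cvg_trans (cvg_within _) _.
  exact: cvg_within.
apply: cvg_trans h; apply: near_eq_cvg.
have n := @nbhs_dnbhs_neq _ t. apply: filterS n.
by move=> s st _; rewrite fg mulrCA mulVf ?mulr1// subr_eq0.
Qed.

Lemma quotient_is_derive T f t d : 0 < t < T ->
  (s - t)^-1 * (f s - f t) @[s --> within [set` `[0, T]] t^'] --> d ->
  is_derive t 1 f d.
Proof.
move=> /andP[t0 tT] h; apply/is_derive1_caratheodory.
exists (fun s => if s == t then d else (s - t)^-1 * (f s - f t)); rewrite eqxx;
  split=> //.
- move=> z; case: eqP => [->|/eqP zt]; first by rewrite !subrr mulr0.
  by rewrite mulrAC mulVf ?mul1r// subr_eq0.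
- apply/continuous_withinNx => /=; rewrite eqxx => P dP.
  have := h _ dP; rewrite /within /= => h1.
  have i : \forall s \near t^', 0 <= s <= T.
    have : \forall s \near t, s \in `]0, T[ by apply: near_in_itvoo;
      rewrite in_itv/= t0.
    move/nbhs_dnbhs; apply: filterS => s; rewrite in_itv/= => /andP[? ?].
    by rewrite !ltW.
  have n := @nbhs_dnbhs_neq _ t.
  suff: \forall s \near t^', P (if s == t then d else (s - t)^-1 * (f s - f t))
    by [].
  near=> s.
  have st : s != t by near: s.
  have si : 0 <= s <= T by near: s.
  have Ps : `[0, T]%classic s -> P ((s - t)^-1 * (f s - f t)) by near: s.
  by rewrite (negbTE st); apply: Ps; rewrite /= in_itv.
Unshelve. all: by end_near. Qed.

(** Multiplying the quotient by [s - t] recovers continuity relative to the interval, including the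
    endpoints, where no two-sided derivative is at hand. *)
Lemma quotient_cvg T f t d :
  (s - t)^-1 * (f s - f t) @[s --> within [set` `[0, T]] t^'] --> d ->
  f s @[s --> within [set` `[0, T]] (nbhs t)] --> f t.
Proof.
move=> h.
have h2 : f t + (s - t) * ((s - t)^-1 * (f s - f t))
    @[s --> within [set` `[0, T]] t^'] --> f t + (t - t) * d.
  apply: cvgD; first exact: cvg_cst.
  apply: cvgM => //; apply: cvgB; last exact: cvg_cst.
  apply: cvg_trans (cvg_within _) _.
  exact: cvg_within.
rewrite subrr mul0r addr0 in h2.
move=> P fP; suff : \forall s \near t, `[0, T]%classic s -> P (f s) by [].
have h3 : \forall s \near t, s != t -> `[0, T]%classic s ->
  P (f t + (s - t) * ((s - t)^-1 * (f s - f t))) := h2 _ fP.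
apply: filterS h3 => s h3 sT; have [->|st] := eqVneq s t;
  first exact: nbhs_singleton.
by have := h3 st sT; rewrite mulVKf ?subr_eq0// addrC subrK.
Qed.

(** The mean value theorem asks for the derivative inside and continuity up to the ends, which is
    what solutions on [[0, T]] provide. *)
Lemma quotient0_cst T f : 0 < T ->
  (forall t, 0 < t < T -> is_derive t 1 f 0) ->
  (forall t, 0 <= t <= T -> f s @[s --> within [set` `[0, T]] (nbhs t)] --> f t) ->
  f T = f 0.
Proof.
move=> T0 df cf.
have d0 (t : R) : t \in `]0, T[ -> is_derive t 1 f 0.
  by rewrite in_itv; exact: df.
have c0 : {within `[0, T], continuous f}.
  by apply/subspace_continuousP => t; rewrite /= in_itv; exact: cf.
have [c _] := MVT_segment (ltW T0) d0 c0.
by rewrite mul0r => /eqP; rewrite subr_eq0 => /eqP.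
Qed.
End one_sided_derivatives.

(** * Identification of the time evolution operator *)

Section time_evolution_flow.
Context {R : realType} (n : nat).
Implicit Types (G Phi : R -> 'M[R[i]]_n).

Lemma has_derivative_onP T (Psi : R -> 'cV[R[i]]_n) (t : R) D :
  has_derivative_on T Psi t D <-> forall i,
    (s - t)^-1 * (complex.Re (Psi s i ord0) - complex.Re (Psi t i ord0))
      @[s --> within [set` `[0, T]] t^'] --> complex.Re (D i ord0) /\
    (s - t)^-1 * (complex.Im (Psi s i ord0) - complex.Im (Psi t i ord0))
      @[s --> within [set` `[0, T]] t^'] --> complex.Im (D i ord0).
Proof.
have E s i : (((s - t)^-1)%:C%C *: (Psi s - Psi t)) i ord0 =
    ((s - t)^-1 * (complex.Re (Psi s i ord0) - complex.Re (Psi t i ord0))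
     +i* ((s - t)^-1 * (complex.Im (Psi s i ord0) - complex.Im (Psi t i ord0))))%C.
  by rewrite !mxE; case: (Psi s i ord0) => ? ?; case: (Psi t i ord0) => ? ?; simpc.
rewrite /has_derivative_on; split=> [/cvg_mx h i|h].
  have := h i ord0; under eq_cvg do rewrite E.
  move=> hi; split.
  - have := continuous_cvg _ (@Re_continuous R (D i ord0)) hi; exact.
  - have := continuous_cvg _ (@Im_continuous R (D i ord0)) hi; exact.
apply/cvg_mx => i j; rewrite ord1; under eq_cvg do rewrite E.
by have [h1 h2] := h i; exact: cvg_complex.
Qed.

Lemma flow_schrodinger_solution T G H Phi (b : 'cV[R[i]]_n) :
  (forall t, 0 <= t <= T -> G t = H t) -> schrodinger_flow G Phi ->
  schrodinger_solution H T (fun t => Phi t *m b).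
Proof.
move=> GH dPhi t tT; exists (- 'i%C *: (G t *m Phi t) *m b).
  have d := mderive_mul (dPhi t) (mderive_cst b t).
  apply/has_derivative_onP => i; have [d1 d2] := d i ord0.
  by rewrite mulmx0 addr0 in d1 d2; split; exact: is_derive_quotient.
rewrite -scalemxAl scalerA mulrN -expr2 sqr_i opprK scale1r -GH//.
by rewrite mulmxA.
Qed.

(** The vector [Phi^* Psi] has derivative zero inside the interval and is continuous up to its ends,
    hence is constant; unitarity of [Phi] then recovers [Psi]. [G] stands for an extension of [H]
    beyond the segment. *)
Lemma schrodinger_solution_flow T G H Phi Psi : 0 < T ->
  (forall t, 0 <= t <= T -> G t = H t) -> (forall t, G t \is hermsymmx) ->
  schrodinger_flow G Phi -> Phi 0 = 1%:M ->
  schrodinger_solution H T Psi -> Psi T = Phi T *m Psi 0.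
Proof.
move=> T0 GH hG dPhi P0 dPsi.
have U := schrodinger_flow_unitary dPhi P0 hG.
pose chi t := (Phi t)^t* *m Psi t.
suff : chi T = chi 0.
  rewrite /chi P0 trmx1 map_mx1 mul1mx => <-.
  by rewrite mulmxA; have /unitarymxP -> := U T; rewrite mul1mx.
have dchi t : 0 < t < T -> mderive chi t 0.
  move=> tT; have tT' : 0 <= t <= T by case/andP: tT => ? ?; rewrite !ltW.
  have [D /has_derivative_onP hD iD] := dPsi t tT'.
  have dPsit : mderive Psi t D.
    by move=> i j; rewrite ord1; have [h1 h2] := hD i; split;
      exact: quotient_is_derive tT _.
  apply: mderive_eq (mderive_mul (mderive_adj (dPhi t)) dPsit) _ _ => //.
  have -> : D = - 'i%C *: (G t *m Psi t).
    by rewrite GH// -iD scalerA mulNr -expr2 sqr_i opprK scale1r.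
  rewrite adj_iM_hermitian// -scalemxAl -scalemxAr -mulmxA scaleNr.
  by rewrite subrr.
have cPsi t i : 0 <= t <= T ->
    complex.Re (Psi s i ord0) @[s --> within `[0, T] (nbhs t)] --> complex.Re
      (Psi t i ord0) /\
    complex.Im (Psi s i ord0) @[s --> within `[0, T] (nbhs t)] --> complex.Im
      (Psi t i ord0).
  move=> tT; have [D /has_derivative_onP hD iD] := dPsi t tT.
  by have [h1 h2] := hD i; split; [exact: quotient_cvg h1|exact: quotient_cvg h2].
have cPhi t i j :
    complex.Re (Phi s i j) @[s --> within `[0, T] (nbhs t)] --> complex.Re (Phi
      t i j) /\
    complex.Im (Phi s i j) @[s --> within `[0, T] (nbhs t)] --> complex.Im (Phi
      t i j).
  have h1 := is_derive_continuous (fun t => (dPhi t i j).1).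
  have h2 := is_derive_continuous (fun t => (dPhi t i j).2).
  by split; apply: cvg_within_filter; [exact: h1|exact: h2].
apply/matrixP => i j; rewrite ord1; apply: complex_ext.
- apply: (quotient0_cst (f := fun s => complex.Re (chi s i ord0)) T0) => t tT.
    by have [] := dchi t tT i ord0; rewrite mxE.
  rewrite /chi; under eq_cvg do rewrite mxE Re_sum; rewrite mxE Re_sum.
  apply: cvg_big => [|k _]; first exact: add_continuous.
  under eq_cvg do rewrite ReM !mxE Re_conj Im_conj;
    rewrite ReM !mxE Re_conj Im_conj.
  have [? ?] := cPhi t k i; have [? ?] := cPsi t k tT.
  by apply: cvgB; apply: cvgM => //; apply: cvgN.
- apply: (quotient0_cst (f := fun s => complex.Im (chi s i ord0)) T0) => t tT.
    by have [] := dchi t tT i ord0; rewrite mxE.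
  rewrite /chi; under eq_cvg do rewrite mxE Im_sum; rewrite mxE Im_sum.
  apply: cvg_big => [|k _]; first exact: add_continuous.
  under eq_cvg do rewrite ImM !mxE Re_conj Im_conj;
    rewrite ImM !mxE Re_conj Im_conj.
  have [? ?] := cPhi t k i; have [? ?] := cPsi t k tT.
  by apply: cvgD; apply: cvgM => //; apply: cvgN.
Qed.

(** [Phi T] is an evolution matrix by uniqueness of solutions. Any other one has the same columns,
    as is seen on the solutions that start at the unit vectors, so the choice in [time_evolution] is
    forced. *)
Lemma time_evolution_flow T G H Phi : 0 < T ->
  (forall t, 0 <= t <= T -> G t = H t) -> (forall t, G t \is hermsymmx) ->
  schrodinger_flow G Phi -> Phi 0 = 1%:M -> time_evolution H T T 0 = Phi T.
Proof.
move=> T0 GH hG dPhi P0.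
have ev : is_time_evolution H T T 0 (Phi T).
  by move=> Psi; exact: (schrodinger_solution_flow T0 GH hG dPhi P0).
rewrite /time_evolution; case: xgetP => [U _ hU|/(_ (Phi T))]; last by move/(_ ev).
apply/matrixP => i j.
have := hU _ (flow_schrodinger_solution (delta_mx j ord0) GH dPhi).
rewrite P0 mul1mx => /matrixP/(_ i ord0).
by rewrite -!colE !mxE.
Qed.

(** The scalar part of [G] commutes with everything and contributes only a phase. *)
Lemma flow_trace_free G Phi : (0 < n)%N -> continuous G ->
  (forall t, G t \is hermsymmx) ->
  schrodinger_flow (fun t => trace_free_part (G t)) Phi ->
  exists2 theta : R -> R, theta 0 = 0 &
    schrodinger_flow G (fun t => (cos (theta t) +i* sin (theta t))%C *: Phi t).
Proof.
move=> n0 cG hG dPhi.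
(* Minus the scalar part of [G], real because a hermitian matrix has real trace; its antiderivative
   is the phase. *)
pose h t := - complex.Re (n%:R^-1 * \tr (G t)).
have ch : continuous h.
  have /continuous_complex[cRe _] : continuous (fun t => n%:R^-1 * \tr (G t)).
    move=> t; apply: cvgM; first exact: cvg_cst.
    apply: cvg_big => [|i _]; first exact: add_continuous.
    exact: (continuous_entry (i := i) (j := i) cG).
  by move=> t; apply: cvgN; exact: cRe.
have [theta th0 dtheta] := antiderivative ch.
exists theta => // t.
have trG : n%:R^-1 * \tr (G t) = (- h t)%:C%C.
  apply: complex_ext; rewrite /= /h ?opprK// ImM.
  have -> : complex.Im (\tr (G t)) = 0.
    rewrite /mxtrace Im_sum big1// => i _.
    have /is_hermitianmxP := hG t; rewrite expr0 scale1r => /matrixP/(_ i i).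
    rewrite !mxE => /(congr1 (@complex.Im R)); rewrite Im_conj; lra.
  have -> : complex.Im (n%:R^-1 : R[i]) = 0.
    by rewrite -(rmorph_nat (real_complex R)) -fmorphV.
  by rewrite mulr0 mul0r addr0.
have de : cderive (fun s => (cos (theta s) +i* sin (theta s))%C) t
    ('i%C * (h t)%:C%C * (cos (theta t) +i* sin (theta t))%C).
  split=> /=.
  - have := @is_derive1_comp _ _ theta t _ _ (is_derive_cos (theta t)) (dtheta t).
    by move/is_derive_eq; apply; ring.
  - have := @is_derive1_comp _ _ theta t _ _ (is_derive_sin (theta t)) (dtheta t).
    by move/is_derive_eq; apply; ring.
move=> i j; apply: cderive_eq (cderiveM de (dPhi t i j)) _ _ => [s|];
  first by rewrite mxE.
rewrite /trace_free_part trG -scalemxAr mulmxBl mul_scalar_mx !mxE.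
have -> : (- h t)%:C%C = - (h t)%:C%C :> R[i] by rewrite rmorphN.
by set e := (_ +i* _)%C; set S := \sum_(_ <- _ | _) _; set x := (h t)%:C%C; ring.
Qed.

End time_evolution_flow.

(** * Chords of a convex domain *)

Section convex_geometry.
Context {R : realType} (n : nat).
Implicit Types (Omega A B : set 'rV[R]_n) (c p q z b : 'rV[R]_n) (s t : R).

Lemma open_boundary Omega : open Omega -> boundary Omega = closure Omega `\` Omega.
Proof. by move=> /interior_id oO; rewrite /boundary oO. Qed.

Lemma closed_boundary Omega : closed (boundary Omega).
Proof.
rewrite /boundary setDE; apply: closedI; first exact: closed_closure.
by rewrite closedC; exact: open_interior.
Qed.

Lemma convex_set_segment Omega p q s :
  convex_set (Omega : set (convex_lmodType 'rV[R]_n)) ->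
  Omega p -> Omega q -> 0 <= s <= 1 -> Omega (p + s *: (q - p)).
Proof.
move=> cO Op Oq /andP[s0 s1].
have := cO q p (Itv01 s0 s1); rewrite !inE => /(_ Oq Op).
congr (Omega _); rewrite /conv/=; apply/matrixP => i j; rewrite !mxE.
by rewrite /unstable.onem; ring.
Qed.

Lemma affine_continuous (a : 'rV[R]_n) (k : R) (f : 'rV[R]_n -> 'rV[R]_n) :
  (forall y, f y = a + k *: y) -> continuous f.
Proof.
move=> /funext -> y; apply: (@cvgD _ _ _ _ (nbhs_filter y)); first exact: cvg_cst.
by apply: (@cvgZr _ _ _ _ (nbhs_filter y)); exact: cvg_id.
Qed.

(** Replace [z] by a nearby point [z'] of [Omega] and shift [c] so that the point at parameter [t]
    stays fixed; for [z'] close to [z] the shifted [c] is still in the open set. *)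
Lemma closure_segment_open Omega c z t : open Omega ->
  convex_set (Omega : set (convex_lmodType 'rV[R]_n)) ->
  Omega c -> closure Omega z -> 0 <= t < 1 -> Omega (c + t *: (z - c)).
Proof.
move=> oO cO Oc Oz /andP[t0 t1].
have t1' : 1 - t != 0 by rewrite subr_eq0 gt_eqF.
have cf : continuous (fun z' => c + (t / (1 - t)) *: (z - z')).
  apply: (@affine_continuous (c + (t / (1 - t)) *: z) (- (t / (1 - t)))) => y.
  by rewrite scalerBr scaleNr addrA.
have h : (c + (t / (1 - t)) *: (z - z')) @[z' --> z] --> c.
  by have := cf z; rewrite /continuous_at subrr scaler0 addr0.
have /h/Oz[z' [Oz' Oc']] : nbhs c Omega by exact: open_nbhs_nbhs.
have := convex_set_segment cO Oc' Oz' (s := t); rewrite t0 (ltW t1) => /(_ isT).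
congr (Omega _); apply/matrixP => i j; rewrite !mxE; field.
by move: t1'; rewrite subr_eq0 eq_sym.
Qed.

Lemma closure_segment Omega p q s : open Omega ->
  convex_set (Omega : set (convex_lmodType 'rV[R]_n)) ->
  closure Omega p -> closure Omega q -> 0 <= s <= 1 ->
  closure Omega (p + s *: (q - p)).
Proof.
move=> oO cO Op Oq /andP[s0]; rewrite le_eqVlt => /predU1P[->|s1].
  by rewrite scale1r addrC subrK.
have cf : continuous (fun p' => p' + s *: (q - p')).
  apply: (@affine_continuous (s *: q) (1 - s)) => y.
  by apply/matrixP => i j; rewrite !mxE; ring.
move=> V hV; have [p' [Op' Vp']] := Op _ (cf p _ hV).
by exists (p' + s *: (q - p')); split=> //; apply: closure_segment_open => //;
  rewrite s0.
Qed.

Lemma closure_norm_le Omega (M : R) : (forall x, Omega x -> `|x| <= M) ->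
  forall x, closure Omega x -> `|x| <= M.
Proof.
move=> hM x cx.
have c : closed [set x : 'rV[R]_n | `|x| <= M].
  apply: (@preimage_closed _ _ (fun x : 'rV[R]_n => `|x|) [set r | r <= M]).
    by move=> y _; exact: norm_continuous.
  exact: closed_le.
by apply: c; apply: closureS cx => y /hM.
Qed.

Lemma compact_closure Omega : bounded_set Omega -> compact (closure Omega).
Proof.
move=> [M [_ hM]]; apply: bounded_closed_compact; last exact: closed_closure.
exists (M + 1); split; first exact: num_real.
move=> N MN b bc /=; apply: closure_norm_le bc => x Ox.
by apply: hM Ox; rewrite (lt_trans _ MN)// ltrDl.
Qed.

Lemma compact_boundary Omega : bounded_set Omega -> compact (boundary Omega).
Proof.
move=> /compact_closure cO; apply: subclosed_compact cO _;
  first exact: closed_boundary.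
by move=> b [].
Qed.

(** The largest parameter at which the ray is still in the closure works: were its point in the open
    set, the ray could be followed further. *)
Lemma ray_boundary Omega c z : open Omega -> bounded_set Omega ->
  closure Omega z -> z != c ->
    exists2 l, 1 <= l & boundary Omega (c + l *: (z - c)).
Proof.
move=> oO [M [_ hM]] Oz zc.
pose E := [set l | 1 <= l /\ closure Omega (c + l *: (z - c))].
have E1 : E 1 by split=> //; rewrite scale1r addrC subrK.
have zc0 : 0 < `|z - c| by rewrite normr_gt0 subr_eq0.
have cf : continuous (fun l : R => c + l *: (z - c)).
  by move=> l; apply: cvgD; [exact: cvg_cst|apply: cvgZl; exact: cvg_id].
have uE : has_ubound E.
  exists ((M + 1 + `|c|) / `|z - c|) => l [l1 Ol]; rewrite ler_pdivlMr//.
  have : `|c + l *: (z - c)| <= M + 1 by apply: closure_norm_le Ol => x /hM;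
    apply; rewrite ltrDl.
  rewrite -[X in X * _](@ger0_norm _ l) ?(le_trans _ l1)// -normrZ => h.
  rewrite -[l *: _](addKr c) addrC (le_trans (ler_normD _ _))// normrN.
  exact: lerD.
have cE : closed E.
  rewrite (_ : E = [set l | 1 <= l] `&` (fun l =>
    c + l *: (z - c)) @^-1` closure Omega)//.
  apply: closedI; first exact: closed_ge.
  by apply: preimage_closed; [move=> l _; exact: cf|exact: closed_closure].
have [s1 Es] : E (sup E).
  by apply: cE; apply: closure_sup => //; exists 1.
exists (sup E) => //; rewrite open_boundary//; split => // Os.
have : \forall l \near sup E, Omega (c + l *: (z - c)) by exact: cf
  (open_nbhs_nbhs _).
move=> /nbhs_ballP[e /= e0 he].
have : E (sup E + e / 2).
  split; first by rewrite (le_trans s1)// lerDl ltW// divr_gt0.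
  apply: subset_closure; apply: he; rewrite -ball_normE /=.
  by rewrite opprD addNKr normrN gtr0_norm ?divr_gt0//; lra.
move=> /(ub_le_sup uE); lra.
Qed.

(** Dimension at least two enters here. If [c0] lies on the line, it is moved along a coordinate [j]
    other than a coordinate [i] in which [q - p] is nonzero: coordinate [i] fixes the parameter on
    the line, and coordinate [j] then gives a contradiction. *)
Lemma exists_off_line Omega p q : (2 <= n)%N -> open Omega -> Omega !=set0 ->
  p != q -> exists2 c, Omega c & forall s, c != p + s *: (q - p).
Proof.
move=> n2 oO [c0 Oc0] pq.
have /rV0Pn[i di] : q - p != 0 by rewrite subr_eq0 eq_sym.
pose j : 'I_n := if val i == 0%N then Ordinal n2 else Ordinal (ltnW n2).
have ij : (i == j) = false by rewrite /j -val_eqE; case: ifP => /= [/eqP ->|].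
pose w : 'rV[R]_n := delta_mx ord0 j.
have cf : continuous (fun e : R => c0 + e *: w).
  by move=> e; apply: cvgD; [exact: cvg_cst|apply: cvgZl; exact: cvg_id].
have : \forall e \near (0 : R), Omega (c0 + e *: w).
  by apply: cf; apply: open_nbhs_nbhs; rewrite scale0r addr0.
move=> /nbhs_ballP[e /= e0 he].
have [[s hs]|hs] := pselect (exists s, c0 = p + s *: (q - p)); last first.
  by exists c0 => // s; apply/eqP => h; apply: hs; exists s.
exists (c0 + (e / 2) *: w).
  by apply: he; rewrite -ball_normE /= sub0r normrN gtr0_norm; lra.
move=> s'; apply/eqP; rewrite hs => /matrixP h.
have := h ord0 i; have := h ord0 j; rewrite !mxE !eqxx ij /= mulr0 mulr1 addr0.
move=> hj /addrI /(mulIf _) si.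
have ss : s = s' by apply: si; move: di; rewrite !mxE.
by move: hj; rewrite ss; lra.
Qed.

(** The segment from [p] to [q] is projected to the boundary from an interior point [c] off the
    line; the parts landing in [A] and in [B] form a closed partition of [[0, 1]], which is
    connected. *)
Lemma boundary_connected Omega A B p q : (2 <= n)%N -> open Omega ->
  Omega !=set0 -> convex_set (Omega : set (convex_lmodType 'rV[R]_n)) ->
  bounded_set Omega -> closed A -> closed B -> A `&` B = set0 ->
  boundary Omega `<=` A `|` B ->
  boundary Omega p -> A p -> boundary Omega q -> A q.
Proof.
move=> n2 oO O0 cO bO clA clB AB0 bAB bp Ap bq.
have [<-//|pq] := eqVneq p q.
have [c Oc cline] := exists_off_line n2 oO O0 pq.
have bdE b : boundary Omega b -> closure Omega b /\ ~ Omega b.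
  by rewrite open_boundary//; case.
(* the parameters of the segment from [p] to [q] whose central projection from
   [c] to the boundary falls in [S] *)
pose P S := [set s : R | 0 <= s <= 1 /\ exists b m, [/\ boundary Omega b, S b,
  0 <= m <= 1 & c + m *: (b - c) = p + s *: (q - p)]].
(* [P S] is the projection to the parameter [s] of a compact set of triples, so continuity of the
   central projection need not be established. *)
have clP S : closed S -> closed (P S).
  move=> clS.
  pose phi (u : 'rV[R]_n * (R * R)) := c + u.2.1 *: (u.1 - c) - (p + u.2.2 *:
    (q - p)).
  have cphi : continuous phi.
    apply/continuous_mx => i j; rewrite /phi.
    under eq_fun do rewrite !mxE.
    have c1 : continuous (fun u : 'rV[R]_n * (R * R) => u.2.1).
      by move=> u; apply: continuous_comp; [exact: cvg_snd|exact: cvg_fst].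
    have c2 : continuous (fun u : 'rV[R]_n * (R * R) => u.2.2).
      by move=> u; apply: continuous_comp; [exact: cvg_snd|exact: cvg_snd].
    have c3 : continuous (fun u : 'rV[R]_n * (R * R) => u.1 i j).
      by move=> u; apply: (@continuous_comp _ _ _ fst (fun v : 'rV[R]_n =>
        v i j)); [exact: cvg_fst|exact: coord_continuous].
    move=> u; apply: cvgB; apply: cvgD; [exact: cvg_cst| |exact: cvg_cst|].
      by apply: cvgM; [exact: c1|apply: cvgB; [exact: c3|exact: cvg_cst]].
    by apply: cvgM; [exact: c2|exact: cvg_cst].
  pose C := (((boundary Omega `&` S) `*` (`[0, 1] `*` `[0, 1]))
    `&` [set u | `|phi u| <= 0])%classic.
  have cC : compact C.
    apply: compact_closedI.
      apply: compact_setX; first by apply: compact_closedI => //;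
        exact: compact_boundary.
      by apply: compact_setX; exact: segment_compact.
    apply: (@preimage_closed _ _ (fun u => `|phi u|) [set r | r <= 0]).
      by move=> u _; apply: (continuous_comp (cphi u)); exact: norm_continuous.
    exact: closed_le.
  rewrite (_ : P S = (fun u => u.2.2) @` C).
    apply: compact_closed; first exact: Rhausdorff.
    apply: continuous_compact => //; apply: continuous_subspaceT => u.
    by apply: continuous_comp; [exact: cvg_snd|exact: cvg_snd].
  apply/seteqP; split=> [s [s01 [b [m [bb Sb m01 e]]]]|s].
    exists (b, (m, s)) => //; split; last by rewrite /= /phi /= e subrr normr0.
    by split=> //=; rewrite !in_itv.
    move=> [[b [m s']]] [/= [[bb Sb]]]; rewrite !in_itv/= => -[m01 s01].
  rewrite normr_le0 subr_eq0 => /eqP e <-; split=> //.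
  by exists b, m.
have P01 s : 0 <= s <= 1 -> P A s \/ P B s.
  move=> s01; pose z := p + s *: (q - p).
  have Oz : closure Omega z by apply: closure_segment => //; [case: bp|case: bq].
  have zc : z != c by rewrite eq_sym cline.
  have [l l1 bl] := ray_boundary oO bO Oz zc.
  have l0 : 0 < l by rewrite (lt_le_trans _ l1).
  have e : c + l^-1 *: (c + l *: (z - c) - c) = z.
    by rewrite (addrC c (l *: _)) addrK scalerA mulVf ?gt_eqF// scale1r addrC subrK.
  have l01 : 0 <= l^-1 <= 1 by rewrite invr_ge0 ltW//= invf_le1.
  have [Ab|Bb] := bAB _ bl; [left|right]; split=> //;
    by exists (c + l *: (z - c)), l^-1.
(* Of two distinct boundary points on one ray from [c], the nearer would lie in [Omega]; so the
   projection is single-valued. *)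
have PAB s : P A s -> P B s -> False.
  move=> [s01 [b1 [m1 [bb1 Ab1 /andP[m10 m11] e1]]]] [_ [b2 [m2 [bb2 Bb2
    /andP[m20 m21] e2]]]].
  have mneq0 m b : c + m *: (b - c) = p + s *: (q - p) -> m != 0.
    move=> e; apply/eqP => m0; move: e; rewrite m0 scale0r addr0 => /eqP.
    by rewrite (negbTE (cline s)).
  have key m b m' b' : boundary Omega b -> boundary Omega b' -> 0 <= m -> m' != 0 ->
      m < m' -> m *: (b - c) = m' *: (b' - c) -> False.
    move=> /bdE[cb _] /bdE[_ nb'] m0 m'0 mm' e; apply: nb'.
    have -> : b' = c + (m / m') *: (b - c).
      by rewrite mulrC -scalerA e scalerA mulVf// scale1r addrC subrK.
    apply: closure_segment_open => //.
    have m'0' : 0 < m' by rewrite (le_lt_trans m0).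
    by rewrite divr_ge0 ?(ltW m'0')//= ltr_pdivrMr// mul1r.
  have e12 : m1 *: (b1 - c) = m2 *: (b2 - c) by apply: (addrI c); rewrite e1.
  have [mm|mm|mm] := ltgtP m1 m2.
  - exact: (key _ _ _ _ bb1 bb2 m10 (mneq0 _ _ e2) mm e12).
  - exact: (key _ _ _ _ bb2 bb1 m20 (mneq0 _ _ e1) mm (esym e12)).
  - move: e12; rewrite mm => /(scalerI (mneq0 _ _ e2))/addIr b12.
    have : (A `&` B) b1 by split=> //; rewrite b12.
    by rewrite AB0.
have PA : P A = `[0, 1]%classic.
  apply: (@segment_connected R 0 1).
  - exists 0; split; first by rewrite lexx ler01.
    by exists p, 1; split=> //;
      rewrite ?ler01 ?lexx// scale1r scale0r addr0 addrC subrK.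
  - exists (~` P B); first by rewrite openC; exact: clP.
    apply/seteqP; split=> s.
      by move=> PAs; split; [case: PAs => s01 _;
        rewrite /= in_itv|move=> /(PAB _ PAs)].
    by move=> [/=]; rewrite in_itv/= => /P01[].
  - exists (P A); first exact: clP.
    by apply/seteqP; split=> s; [move=> PAs; split=> //; case: PAs => ? _;
      rewrite /= in_itv|case].
(* At [s = 1] the projected point is [q] itself: [m < 1] would put [q] inside [Omega]. *)
have [_ [b [m [bb Ab /andP[m0 m1] e]]]] : P A 1 by rewrite PA /= in_itv/= ler01
  lexx.
move: e; rewrite scale1r (addrC p) subrK => e.
move: m1; rewrite le_eqVlt => /predU1P[m1|m1].
  by move: Ab; rewrite -e m1 scale1r (addrC c) subrK.
have [_] := bdE q bq; case; rewrite -e; apply: closure_segment_open => //.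
- by have [] := bdE b bb.
- by rewrite m0.
Qed.

End convex_geometry.

(** * The weight and its X-ray transform *)

Section tensor_weight.
Import mxtens.
Local Notation "A *t B" := (tensmx A B) (at level 40, left associativity).
Context {R : realType} (n : nat).
Implicit Types A B X : 'M[R[i]]_n.

Lemma tens1mx1 : 1%:M *t 1%:M = 1%:M :> 'M[R[i]]_(n * n).
Proof.
apply/matrixP => i j; case: (mxtens_indexP i) => a b;
  case: (mxtens_indexP j) => c d.
rewrite tensmxE !mxE (inj_eq (can_inj (@mxtens_indexK n n))) xpair_eqE.
by case: eqP; case: eqP => _ _; rewrite ?(mul0r, mulr0, mul1r).
Qed.

Lemma unitarymx_tens A B : A \is unitarymx -> B \is unitarymx ->
  A *t B \is unitarymx.
Proof.
move=> /unitarymxP hA /unitarymxP hB; apply/unitarymxP.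
by rewrite trmx_tens map_mxT tensmx_mul hA hB tens1mx1.
Qed.

Lemma prod_mxtens (F : 'I_n -> 'I_n -> R[i]) :
  \prod_(k < n * n) F (mxtens_unindex k).1 (mxtens_unindex k).2 =
  \prod_i \prod_j F i j.
Proof.
rewrite pair_bigA (reindex (@mxtens_index n n)); last first.
  by exists (@mxtens_unindex n n) => k _;
    [exact: mxtens_indexK|exact: mxtens_unindexK].
by apply: eq_bigr => -[i j] _; rewrite mxtens_indexK.
Qed.

Lemma det_tens_diag (d e : 'rV[R[i]]_n) :
  \det (diag_mx d *t diag_mx e) = \det (diag_mx d) ^+ n * \det (diag_mx e) ^+ n.
Proof.
have -> : diag_mx d *t diag_mx e = diag_mx (\row_k
    (d ord0 (mxtens_unindex k).1 * e ord0 (mxtens_unindex k).2)).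
  apply/matrixP => i j; case: (mxtens_indexP i) => a b;
    case: (mxtens_indexP j) => a' b'.
  rewrite tensmxE !mxE mxtens_indexK (inj_eq (can_inj (@mxtens_indexK n n)))
    xpair_eqE.
  by case: eqP; case: eqP => _ _; rewrite ?(mul0r, mulr0, mulr0n, mulr1n).
rewrite !det_diag; under eq_bigr do rewrite mxE.
rewrite (prod_mxtens (fun i j => d ord0 i * e ord0 j)).
under eq_bigr do rewrite big_split.
by rewrite big_split /= exchange_big /= !prodr_const card_ord.
Qed.

(** Normality lets the spectral theorem reduce the formula to diagonal matrices; the unitary
    matrices of the weight are normal. *)
Lemma det_tens A B : A \is normalmx -> B \is normalmx ->
  \det (A *t B) = \det A ^+ n * \det B ^+ n.
Proof.
move=> /orthomx_spectralP eA /orthomx_spectralP eB.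
set P := spectralmx A in eA; set d := spectral_diag A in eA.
set Q := spectralmx B in eB; set e := spectral_diag B in eB.
have uP : invmx P *m P = 1%:M by rewrite mulVmx// spectral_unit.
have uQ : invmx Q *m Q = 1%:M by rewrite mulVmx// spectral_unit.
have detC (m : nat) (S T D : 'M[R[i]]_m) : S *m T = 1%:M ->
  \det (S *m D *m T) = \det D.
  by move=> ST; rewrite !det_mulmx mulrAC -det_mulmx ST det1 mul1r.
rewrite [in RHS]eA [in RHS]eB !detC// -det_tens_diag.
rewrite [in LHS]eA [in LHS]eB -!tensmx_mul; apply: detC.
by rewrite tensmx_mul uP uQ tens1mx1.
Qed.

Lemma unitarymx_normal A : A \is unitarymx -> A \is normalmx.
Proof.
move=> uA; apply/normalmxP; move/unitarymxP: (uA) => ->.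
by rewrite -trmxC_unitary in uA; move/unitarymxP: uA; rewrite trmxCK.
Qed.

Lemma special_unitary_tens A B : special_unitary A -> special_unitary B ->
  special_unitary (A *t B).
Proof.
move=> [uA dA] [uB dB]; split; first exact: unitarymx_tens.
by rewrite det_tens ?unitarymx_normal// dA dB !expr1n mulr1.
Qed.

(** Vectorization by rows, with the index bijection of the tensor product. *)
Definition mx_col X : 'cV[R[i]]_(n * n) :=
  \col_k X (mxtens_unindex k).1 (mxtens_unindex k).2.

(** With [A = P_1^*] and [B] the transpose of [P_2], the map [X |-> P_1^* X P_2] becomes
    multiplication by a tensor product. *)
Lemma tens_mx_col A B X : A *t B *m mx_col X = mx_col (A *m X *m B^T).
Proof.
apply/matrixP => k l; rewrite ord1 !mxE {l}.
rewrite (reindex (@mxtens_index n n)); last first.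
  by exists (@mxtens_unindex n n) => u _;
    [exact: mxtens_indexK|exact: mxtens_unindexK].
under eq_bigr do rewrite !mxE mxtens_indexK.
rewrite -(pair_bigA _ (fun i j => A _ i * B _ j * X i j))/= exchange_big.
apply: eq_bigr => j _; rewrite mxE mulr_suml; apply: eq_bigr => i _.
by rewrite mxE mulrAC.
Qed.

Lemma special_unitary_adj A : special_unitary A -> special_unitary (A^t*).
Proof.
move=> [uA dA]; split; first by rewrite trmxC_unitary.
by rewrite det_map_mx det_tr dA rmorph1.
Qed.

Lemma special_unitary_tr A : special_unitary A -> special_unitary (A^T).
Proof. by move=> [uA dA]; split; [rewrite trmx_unitary|rewrite det_tr]. Qed.

Lemma mx_col_eq0 X : mx_col X = 0 -> X = 0.
Proof.
move=> X0; apply/matrixP => i j.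
by have /matrixP/(_ (mxtens_index (i, j)) ord0) := X0; rewrite !mxE mxtens_indexK.
Qed.

End tensor_weight.

(** * Continuity of matrix operations *)

Section matrix_continuity.
Context {R : realType} (X : topologicalType).

Lemma complexB_continuous (f g : X -> R[i]) :
  continuous f -> continuous g -> continuous (fun x => f x - g x).
Proof. by move=> cf cg x; apply: cvgB; [exact: cf|exact: cg]. Qed.

Lemma complexM_continuous (f g : X -> R[i]) :
  continuous f -> continuous g -> continuous (fun x => f x * g x).
Proof. by move=> cf cg x; apply: cvgM; [exact: cf|exact: cg]. Qed.

Lemma complexX_continuous k (f : X -> R[i]) :
  continuous f -> continuous (fun x => f x ^+ k).
Proof.
move=> cf; elim: k => [|k IH]; first by move=> x; exact: cvg_cst.
by under eq_fun do rewrite exprS; exact: complexM_continuous.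
Qed.

Lemma complex_sum_continuous (I : finType) (f : I -> X -> R[i]) :
  (forall i, continuous (f i)) -> continuous (fun x => \sum_i f i x).
Proof.
move=> cf x; apply: cvg_big => [|i _]; first exact: add_continuous.
exact: cf.
Qed.

Lemma mulmx_continuous m n p (A : X -> 'M[R[i]]_(m, n)) (B : X -> 'M[R[i]]_(n, p)) :
  continuous A -> continuous B -> continuous (fun x => A x *m B x).
Proof.
move=> cA cB; apply/continuous_mx => i j; under eq_fun do rewrite mxE.
move=> x; apply: cvg_big => [|k _]; first exact: add_continuous.
by apply: cvgM; [exact: continuous_entry cA _|exact: continuous_entry cB _].
Qed.

Lemma trmx_continuous m n (A : X -> 'M[R[i]]_(m, n)) :
  continuous A -> continuous (fun x => (A x)^T).
Proof.
move=> cA; apply/continuous_mx => i j; under eq_fun do rewrite mxE.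
exact: continuous_entry cA.
Qed.

Lemma adjmx_continuous m n (A : X -> 'M[R[i]]_(m, n)) :
  continuous A -> continuous (fun x => (A x)^t*).
Proof.
move=> cA; apply/continuous_mx => i j; apply/continuous_complex.
have /continuous_complex[cRe cIm] := continuous_entry (i := j) (j := i) cA.
split.
- by under eq_fun do rewrite !mxE Re_conj; exact: cRe.
- by under eq_fun do rewrite !mxE Im_conj; move=> x; apply: cvgN; exact: cIm.
Qed.

Lemma mxtrace_continuous n (A : X -> 'M[R[i]]_n) :
  continuous A -> continuous (fun x => \tr (A x)).
Proof.
move=> cA x; apply: cvg_big => [|k _]; first exact: add_continuous.
exact: continuous_entry cA _.
Qed.

Lemma mxB_continuous m n (A B : X -> 'M[R[i]]_(m, n)) :
  continuous A -> continuous B -> continuous (fun x => A x - B x).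
Proof.
move=> cA cB; apply/continuous_mx => i j; under eq_fun do rewrite !mxE.
by move=> x; apply: cvgB;
  [exact: continuous_entry cA _|exact: continuous_entry cB _].
Qed.

Lemma trace_free_part_continuous n (A : X -> 'M[R[i]]_n) :
  continuous A -> continuous (fun x => trace_free_part (A x)).
Proof.
move=> cA; apply: (mxB_continuous cA); apply/continuous_mx => i j.
have ct : continuous (fun x => n%:R^-1 * \tr (A x)).
  by move=> x; apply: cvgM; [exact: cvg_cst|exact: (mxtrace_continuous cA)].
rewrite /scalar_mx; under eq_fun do rewrite mxE.
case: eqP => _; first exact: ct.
by move=> x; exact: cvg_cst.
Qed.
Lemma mx_col_continuous n (A : X -> 'M[R[i]]_n) :
  continuous A -> continuous (fun x => mx_col (A x)).
Proof.
move=> cA; apply/continuous_mx => i j; under eq_fun do rewrite mxE.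
exact: continuous_entry cA.
Qed.

Lemma tensmx_continuous n (A B : X -> 'M[R[i]]_n) :
  continuous A -> continuous B -> continuous (fun x => mxtens.tensmx (A x) (B x)).
Proof.
move=> cA cB; apply/continuous_mx => i j; under eq_fun do rewrite mxE.
by apply: complexM_continuous;
  [exact: continuous_entry cA|exact: continuous_entry cB].
Qed.

End matrix_continuity.

(** * Bounded hermitian extension of a Hamiltonian *)

Section extension.
Context {R : realType} (n : nat).
Implicit Types (Omega : set 'rV[R]_n).

Lemma half_continuous (X : topologicalType) (op : R -> R -> R) (f g : X -> R) :
  continuous (fun p => op p.1 p.2) -> continuous f -> continuous g ->
  continuous (fun x => op (f x) (g x) / 2).
Proof.
move=> cop cf cg x; apply: cvgM; last exact: cvg_cst.
exact: (pair_comp_continuous (f := fun p => op p.1 p.2) cop cf cg).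
Qed.

(** Compactness bounds [f], so the bounded form of Tietze's theorem applies; the bound [M] is what
    global existence of propagators requires. *)
Lemma compact_extension (A : set 'rV[R]_n) (f : 'rV[R]_n -> R) : compact A ->
  {within A, continuous f} ->
  exists g M, [/\ forall x, A x -> g x = f x, continuous g & forall x, `|g x| <= M].
Proof.
move=> cA cf.
have clA : closed A by apply: compact_closed => //; exact: norm_hausdorff.
have /compact_bounded[M [_ hM]] := continuous_compact cf cA.
have M0 : 0 < `|M| + 1 by rewrite ltr_wpDl.
have fM x : A x -> `|f x| <= `|M| + 1.
  move=> Ax; apply: hM; last by exists x.
  by rewrite (le_lt_trans (ler_norm _))// ltrDl.
have N : normal_space 'rV[R]_n by exact: pseudometric_normal.
have [g [fg cg gM]] := continuous_bounded_extension N clA M0 cf fM.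
exists g, (`|M| + 1); split=> // x Ax.
by rewrite fg// inE.
Qed.

Lemma hermitian_extension N (A : set 'rV[R]_n) (H : 'rV[R]_n -> 'M[R[i]]_N) :
  compact A -> {within A, continuous H} -> (forall x, A x -> H x \is hermsymmx) ->
  exists G C, [/\ forall x, A x -> G x = H x, continuous G,
    forall x, G x \is hermsymmx & 0 <= C /\ forall x i j, `|G x i j| <= C%:C%C].
Proof.
move=> cA cH hH.
have cHe i j : continuous ((fun x => H x i j) : subspace A -> R[i]).
  exact: (@continuous_entry _ (subspace A) _ _ H i j cH).
pose part (u : 'I_N * 'I_N * bool) (x : 'rV[R]_n) : R :=
  if u.2 then complex.Im (H x u.1.1 u.1.2) else complex.Re (H x u.1.1 u.1.2).
have /choice[gM hgM] : forall u, exists gM : ('rV[R]_n -> R) * R,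
    [/\ forall x, A x -> gM.1 x = part u x, continuous gM.1 & forall x, `|gM.1
      x| <= gM.2].
  move=> u; have cu : {within A, continuous (part u)}.
    have /(@continuous_complex _ (subspace A))[cRe cIm] := cHe u.1.1 u.1.2.
    by rewrite /part; case: u.2; [exact: cIm|exact: cRe].
  by have [g [M hg]] := compact_extension cA cu; exists (g, M).
pose re i j := (gM (i, j, false)).1; pose im i j := (gM (i, j, true)).1.
pose M := \sum_u `|(gM u).2|.
have bM u x : `|(gM u).1 x| <= M.
  have [_ _ h] := hgM u; rewrite (le_trans (h x))// (le_trans (ler_norm _))//.
  by rewrite /M (bigD1 u)//= lerDl sumr_ge0.
(* Real and imaginary parts of the entries are extended independently, which destroys hermiticity;
   taking the hermitian part restores it and changes nothing on [A]. *)
exists (fun x => \matrix_(i, j) ((re i j x + re j i x) / 2 +i* ((im i j x - im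
  j i x) / 2))%C).
exists (2 * M); split.
- move=> x Ax; apply/matrixP => i j.
  have /is_hermitianmxP := hH x Ax; rewrite expr0 scale1r => /matrixP/(_ i j).
  rewrite !mxE /re /im; have h u : (gM u).1 x = part u x by have [-> ] := hgM u.
  rewrite !h /part/= => e.
  have eRe := congr1 (@complex.Re R) e; have eIm := congr1 (@complex.Im R) e.
  rewrite Re_conj in eRe; rewrite Im_conj in eIm.
  by apply: complex_ext => /=; lra.
- apply/continuous_mx => i j; apply/continuous_complex.
  have cg u : continuous (gM u).1 by have [] := hgM u.
  split; under eq_fun do rewrite mxE /=.
    exact: (half_continuous (op := +%R) add_continuous (cg (i, j, false)) (cg
      (j, i, false))).
  have cs : continuous (fun p : R * R => p.1 - p.2).
    by move=> p; apply: cvgB; [exact: cvg_fst|exact: cvg_snd].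
  exact: (half_continuous (op := fun a b =>
    a - b) cs (cg (i, j, true)) (cg (j, i, true))).
- move=> x; apply/is_hermitianmxP; rewrite expr0 scale1r.
  apply/matrixP => i j; rewrite !mxE; apply: complex_ext;
    rewrite ?Re_conj ?Im_conj/=.
    by rewrite addrC.
  by lra.
- split=> [|x i j]; first by rewrite mulr_ge0// sumr_ge0.
  rewrite mxE; apply: le_trans (normc_le_ReIm _) _; rewrite lecR /=.
  have := bM (i, j, false) x; have := bM (j, i, false) x.
  have := bM (i, j, true) x; have := bM (j, i, true) x.
  rewrite -/(re i j) -/(re j i) -/(im i j) -/(im j i) !ler_norml.
  move=> /andP[? ?] /andP[? ?] /andP[? ?] /andP[? ?].
  have h1 : `|(re i j x + re j i x) / 2| <= M by rewrite ler_norml; apply/andP;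
    split; lra.
  have h2 : `|(im i j x - im j i x) / 2| <= M by rewrite ler_norml; apply/andP;
    split; lra.
  by rewrite mulr_natl; exact: lerD.
Qed.
End extension.

Section ftc.
Context {R : realType}.

Lemma integral_derive (f F : R -> R) (T : R) : 0 < T -> continuous f ->
  (forall t : R, is_derive t 1 F (f t)) ->
  \int[lebesgue_measure]_(t in [set` `[0, T]]) f t = F T - F 0.
Proof.
move=> T0 cf dF.
have cF := is_derive_continuous dF.
rewrite /Rintegral (@continuous_FTC2 _ f F)//.
- exact: continuous_subspaceT.
- split; first by move=> x _; have [] := dF x.
  + by apply: cvg_at_right_filter; exact: cF.
  + by apply: cvg_at_left_filter; exact: cF.
- by move=> x _; rewrite derive1E; have [_ ->] := dF x.
Qed.

Lemma complex_integral_derive (f F : R -> R[i]) (T : R) : 0 < T -> continuous f ->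
  (forall t, cderive F t (f t)) -> complex_integral T f = F T - F 0.
Proof.
move=> T0 /continuous_complex[cRe cIm] dF; rewrite /complex_integral.
rewrite (integral_derive T0 cRe (fun t => (dF t).1)).
rewrite (integral_derive T0 cIm (fun t => (dF t).2)).
by case: (F T) => ? ?; case: (F 0).
Qed.
End ftc.

(** * Propagators along lines *)

Section flow_operations.
Context {R : realType} (N : nat).
Implicit Types (G Phi Psi : R -> 'M[R[i]]_N) (A B : 'M[R[i]]_N).

Lemma schrodinger_flow_eq G G' Phi Phi' :
  schrodinger_flow G Phi -> G =1 G' -> Phi =1 Phi' -> schrodinger_flow G' Phi'.
Proof. by move=> h /funext <- /funext <-. Qed.

Lemma schrodinger_flow_affine G Phi (a b : R) : schrodinger_flow G Phi ->
  schrodinger_flow (fun t => a%:C%C *: G (a * t + b)) (fun t => Phi (a * t + b)).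
Proof.
move=> h t i j; have := cderive_comp_affine (h (a * t + b) i j).
move=> /cderive_eq; apply => //.
by rewrite -scalemxAl !mxE mulrCA.
Qed.

Lemma schrodinger_flow_unique G Phi Psi : schrodinger_flow G Phi -> Phi 0 = 1%:M ->
  (forall t, G t \is hermsymmx) -> schrodinger_flow G Psi ->
  forall t, Psi t = Phi t *m Psi 0.
Proof.
move=> hPhi P0 hG hPsi t.
have /unitarymxP U := schrodinger_flow_unitary hPhi P0 hG t.
have h : (Phi t)^t* *m Psi t = Psi 0.
  rewrite (@mderive0_cst _ _ _ (fun s => (Phi s)^t* *m Psi s) _ t 0).
    by rewrite P0 trmx1 map_mx1 mul1mx.
  move=> s; apply: mderive_eq (schrodinger_flow_adj_mul hPhi hPsi (hG s)) _ _ => //.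
  by rewrite subrr mulmx0 mul0mx scaler0.
by rewrite -h mulmxA U mul1mx.
Qed.

Lemma hermsymmx_scale (a : R) A : A \is hermsymmx -> a%:C%C *: A \is hermsymmx.
Proof.
move=> /is_hermitianmxP; rewrite expr0 scale1r => hA.
apply/is_hermitianmxP; rewrite expr0 scale1r {1}hA.
apply/matrixP => i j; rewrite !mxE rmorphM; congr (_ * _).
by apply: complex_ext; rewrite /= ?oppr0.
Qed.

Lemma trace_free_part_hermitian A : A \is hermsymmx ->
  trace_free_part A \is hermsymmx.
Proof.
move=> /is_hermitianmxP; rewrite expr0 scale1r => hA.
apply/is_hermitianmxP; rewrite expr0 scale1r /trace_free_part.
have c : Num.conj (N%:R^-1 * \tr A) = N%:R^-1 * \tr A :> R[i].
  rewrite rmorphM fmorphV rmorph_nat; congr (_ * _).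
  by rewrite [in RHS]hA trace_map_mx mxtrace_tr.
apply/matrixP => i j; rewrite {1}hA !mxE rmorphB rmorphMn/= c eq_sym.
by [].
Qed.

Lemma trace_free_part_trace A : (0 < N)%N -> \tr (trace_free_part A) = 0.
Proof.
move=> N0; rewrite /trace_free_part raddfB /= mxtrace_scalar -[_ *+ N]mulr_natl
  mulrA.
by rewrite divff ?mul1r ?subrr// pnatr_eq0 -lt0n.
Qed.

Lemma trace_free_part_bound A (C : R) : (0 < N)%N -> 0 <= C ->
  (forall i j, `|A i j| <= C%:C%C) ->
  forall i j, `|trace_free_part A i j| <= (2 * C)%:C%C.
Proof.
move=> N0 C0 hA i j; rewrite !mxE (le_trans (ler_normB _ _))//.
have -> : (2 * C)%:C%C = C%:C%C + C%:C%C :> R[i] by rewrite -rmorphD;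
  congr _%:C%C; ring.
(* The normalised trace is a mean of [N] entries, each of size at most [C]. *)
apply: lerD => //.
apply: (@le_trans _ _ `|N%:R^-1 * \tr A|).
  by case: eqP => _; rewrite ?mulr1n// mulr0n normr0.
rewrite normrM normfV normr_nat ler_pdivrMl ?ltr0n//.
rewrite (le_trans (ler_norm_sum _ _ _))// (@le_trans _ _ (\sum_(k < N) C%:C%C))//.
  by apply: ler_sum.
by rewrite sumr_const card_ord mulr_natl.
Qed.

End flow_operations.

(** * A common propagator for all lines and chords *)

Section line_propagator.
Context {R : realType} (n N : nat).
Local Notation V := 'rV[R]_n.

Definition clamp (L r : R) : R := Num.max (- L) (Num.min r L).

Lemma clamp_continuous L : continuous (clamp L).
Proof.
move=> r; apply: (@continuous_max _ _ (fun=> - L) (fun r => Num.min r L)).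
  exact: cvg_cst.
by apply: (@continuous_min _ _ id (fun=> L)); [exact: cvg_id|exact: cvg_cst].
Qed.

Lemma clamp_id L r : `|r| <= L -> clamp L r = r.
Proof.
by rewrite ler_norml => /andP[h1 h2]; rewrite /clamp (min_l h2) (max_r h1).
Qed.

Lemma clamp_bound L r : 0 <= L -> `|clamp L r| <= L.
Proof.
move=> L0; rewrite ler_norml /clamp le_max lexx /= ge_max ge_min lexx orbT andbT.
by rewrite (le_trans _ L0)// oppr_le0.
Qed.

(* At [((b, w, r), t)] this is [r * G (b + t * w)]: the Hamiltonian along a line
   through [b], with time rescaled by [r]. Clamping [r] to [[- L, L]] only serves
   to keep the generator bounded. *)
Definition line_generator (G : V -> 'M[R[i]]_N) (L : R) (p : V * V * R * R) :=
  (clamp L p.1.2)%:C%C *: G (p.1.1.1 + p.2 *: p.1.1.2).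

Lemma line_generator_continuous (G : V -> 'M[R[i]]_N) (L : R) :
  continuous G -> continuous (line_generator G L).
Proof.
move=> cG.
have c1 : continuous (fun p : V * V * R * R => p.1.1.1).
  move=> p; apply: (@continuous_comp _ _ _ (fun p : V * V * R * R =>
    p.1.1) fst); last exact: cvg_fst.
  by apply: continuous_comp; exact: cvg_fst.
have c2 : continuous (fun p : V * V * R * R => p.1.1.2).
  move=> p; apply: (@continuous_comp _ _ _ (fun p : V * V * R * R =>
    p.1.1) snd); last exact: cvg_snd.
  by apply: continuous_comp; exact: cvg_fst.
have c3 : continuous (fun p : V * V * R * R => p.1.2).
  by move=> p; apply: (@continuous_comp _ _ _ fst snd);
    [exact: cvg_fst|exact: cvg_snd].
have c4 : continuous (fun p : V * V * R * R => p.2) by move=> p; exact: cvg_snd.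
have cx : continuous (fun p : V * V * R * R => p.1.1.1 + p.2 *: p.1.1.2).
  apply/continuous_mx => i j; under eq_fun do rewrite !mxE.
  have e1 := (continuous_mx _).1 c1 i j; have e2 := (continuous_mx _).1 c2 i j.
  by move=> p; apply: cvgD; [exact: e1|apply: cvgM; [exact: c4|exact: e2]].
have ccl : continuous (fun p : V * V * R * R => (clamp L p.1.2)%:C%C).
  apply/continuous_complex; split=> /= p; last exact: cvg_cst.
  by apply: (continuous_comp (c3 p)); exact: clamp_continuous.
have cGx : continuous (fun p : V * V * R * R => G (p.1.1.1 + p.2 *: p.1.1.2)).
  by move=> p; apply: (continuous_comp (cx p)); exact: cG.
apply/continuous_mx => i j; rewrite /line_generator; under eq_fun do rewrite mxE.
have e := continuous_entry (i := i) (j := j) cGx.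
by move=> p; apply: cvgM; [exact: ccl|exact: e].
Qed.

Lemma line_propagator (G : V -> 'M[R[i]]_N) (C L : R) : continuous G ->
  0 <= C -> (forall x i j, `|G x i j| <= C%:C%C) -> 0 <= L ->
  exists Phi : V * V * R * R -> 'M[R[i]]_N,
    [/\ continuous Phi, forall u, Phi (u, 0) = 1%:M &
        forall u, schrodinger_flow (fun t => line_generator G L (u, t))
                                   (fun t => Phi (u, t))].
Proof.
move=> cG C0 bG L0; apply: (@propagator _ _ _ _ (L * C)).
- exact: line_generator_continuous.
- by rewrite mulr_ge0.
- move=> p i j; rewrite mxE normrM rmorphM; apply: ler_pM => //.
  have := clamp_bound p.1.2 L0; rewrite -lecR; apply: le_trans.
  by rewrite (le_trans (normc_le_ReIm _))//= normr0 addr0.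
Qed.

End line_propagator.

(** * Euclidean structure and unit speed chords *)

Section euclidean.
Context {R : realType} (n : nat).
Local Notation V := 'rV[R]_n.

Definition dot (x v : V) : R := \sum_(i < n) x ord0 i * v ord0 i.

Lemma sphere_dot v : @sphere R n v -> dot v v = 1.
Proof.
rewrite /sphere /= /euclidean_norm => h; have : 0 <= \sum_(i < n) v ord0 i ^+ 2.
  by apply: sumr_ge0 => i _; exact: sqr_ge0.
by move/sqr_sqrtr; rewrite h expr1n => e; rewrite /dot -[RHS]/1 [RHS]e.
Qed.

Lemma dot_line x v t : @sphere R n v -> dot (x + t *: v) v = dot x v + t.
Proof.
move=> /sphere_dot vv; rewrite -[in RHS](mulr1 t) -vv /dot mulr_sumr -big_split.
by apply: eq_bigr => i _; rewrite !mxE /=; ring.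
Qed.

Lemma euclidean_normZ a (v : V) : euclidean_norm (a *: v) = `|a| * euclidean_norm v.
Proof.
rewrite /euclidean_norm -sqrtr_sqr -sqrtrM ?sqr_ge0// mulr_sumr.
by congr Num.sqrt; apply: eq_bigr => i _; rewrite mxE exprMn.
Qed.

Lemma euclidean_norm_gt0 (v : V) : v != 0 -> 0 < euclidean_norm v.
Proof.
move=> /rV0Pn[i vi]; rewrite /euclidean_norm sqrtr_gt0 (bigD1 i)//=.
by rewrite ltr_pwDl ?exprn_even_gt0// sumr_ge0// => j _; exact: sqr_ge0.
Qed.

Lemma coordinate_continuous (i : 'I_n) : continuous (fun x : V => x ord0 i).
Proof. exact: coord_continuous. Qed.

Lemma euclidean_norm_continuous : continuous (@euclidean_norm R n).
Proof.
move=> v; apply: (@continuous_comp _ _ _ (fun v : V =>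
  \sum_(i < n) v ord0 i ^+ 2) Num.sqrt).
  apply: (@cvg_big _ _ _ _ _ _ _ (nbhs v)) => [|i _]; first exact: add_continuous.
  have := @coordinate_continuous i v.
  by move=> c; apply: (continuous_comp (g := fun r : R => r ^+ 2) c);
    exact: exprn_continuous.
exact: sqrt_continuous.
Qed.

Lemma dot_continuous : continuous (fun p : V * V => dot p.1 p.2).
Proof.
move=> p; apply: cvg_big => [|i _]; first exact: add_continuous.
apply: cvgM.
- by apply: (continuous_comp (f := fst) (g := fun x : V => x ord0 i));
  [exact: cvg_fst|exact: coordinate_continuous].
- by apply: (continuous_comp (f := snd) (g := fun x : V => x ord0 i));
  [exact: cvg_snd|exact: coordinate_continuous].
Qed.

Lemma chord_line_through (Omega : set V) p q : open Omega ->
  convex_set (Omega : set (convex_lmodType V)) ->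
  boundary Omega p -> boundary Omega q -> p != q ->
  line_through Omega p ((euclidean_norm (q - p))^-1 *: (q - p)) (euclidean_norm
    (q - p)).
Proof.
move=> oO cO bp bq pq; set T := euclidean_norm _.
have T0 : 0 < T by rewrite euclidean_norm_gt0// subr_eq0 eq_sym.
have seg t : segment_path p (T^-1 *: (q - p)) t = p + (t / T) *: (q - p).
  by rewrite /segment_path scalerA.
split => //.
- by rewrite /sphere /= euclidean_normZ gtr0_norm ?invr_gt0// mulVf ?gt_eqF.
- move=> t /andP[t0 tT]; rewrite seg; apply: closure_segment => //.
  + by case: bp.
  + by case: bq.
  + by rewrite divr_ge0 ?(ltW T0)//= ler_pdivrMr// mul1r.
- by rewrite seg mul0r scale0r addr0.
- by rewrite seg divff ?gt_eqF// scale1r addrC subrK.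
Qed.
End euclidean.

Section line_evolution.
Context {R : realType} (n N : nat).
Local Notation V := 'rV[R]_n.
Variables (G : V -> 'M[R[i]]_N) (L : R) (Phi : V * V * R * R -> 'M[R[i]]_N).
Hypotheses (N_gt0 : (0 < N)%N) (Gcont : continuous G).
Hypothesis Gherm : forall x, G x \is hermsymmx.
Let G0 x := trace_free_part (G x).
Hypotheses (Phi0 : forall u, Phi (u, 0) = 1%:M)
  (Phi_flow : forall u, schrodinger_flow (fun t => line_generator G0 L (u, t))
                                         (fun t => Phi (u, t))).

Let G0herm x : G0 x \is hermsymmx.
Proof. exact: trace_free_part_hermitian. Qed.

Let generator_herm p : line_generator G0 L p \is hermsymmx.
Proof. exact: hermsymmx_scale. Qed.

Lemma line_propagator_unitary p : Phi p \is unitarymx.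
Proof.
case: p => u t; exact: (schrodinger_flow_unitary (Phi_flow u) (Phi0 u) (fun s
  => generator_herm (u, s))).
Qed.

Lemma line_propagator_det p : \det (Phi p) = 1.
Proof.
case: p => u t; apply: (schrodinger_flow_det (Phi_flow u) (Phi0 u)) => s.
by rewrite /line_generator mxtraceZ trace_free_part_trace// mulr0.
Qed.

(** Velocity [T *: v] together with the factor [T] covers the chord in unit time; slowing time down
    by [T] returns the unit speed equation. *)
Lemma line_propagator_chord x v (T : R) : 0 < T <= L ->
  schrodinger_flow (fun t => G0 (x + t *: v)) (fun t =>
    Phi (x, T *: v, T, T^-1 * t)).
Proof.
move=> /andP[T0 TL].
have := schrodinger_flow_affine (T^-1) 0 (Phi_flow (x, T *: v, T)).
move/schrodinger_flow_eq; apply=> t; last by rewrite addr0.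
rewrite /line_generator /= clamp_id ?gtr0_norm// addr0 !scalerA -rmorphM.
by rewrite mulVf ?gt_eqF// scale1r mulrAC mulVf ?gt_eqF// mul1r.
Qed.

Lemma line_propagator_unit x v (s : R) : 1 <= L ->
  schrodinger_flow (fun t => G0 (x + (s + t) *: v)) (fun t => Phi (x, v, 1, s + t)).
Proof.
move=> L1; have := schrodinger_flow_affine 1 s (Phi_flow (x, v, 1)).
move/schrodinger_flow_eq; apply=> t; last by rewrite mul1r addrC.
by rewrite /line_generator /= clamp_id ?normr1// (_ : 1%:C%C = 1 :> R[i])//
  !scale1r mul1r (addrC s).
Qed.

(** For factor zero the generator vanishes. This covers the chord of length zero, the starting value
    for the connectedness argument. *)
Lemma line_propagator_degenerate x v t : 0 <= L -> Phi (x, v, 0, t) = 1%:M.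
Proof.
move=> L0; rewrite (mderive0_cst (A := fun t =>
  Phi (x, v, 0, t)) _ t 0) ?Phi0// => s.
apply: mderive_eq (Phi_flow (x, v, 0) s) _ _ => //.
rewrite /line_generator /= clamp_id ?normr0//.
by rewrite (_ : 0%:C%C = 0 :> R[i])// scale0r mul0mx scaler0.
Qed.

Lemma line_evolution_propagator Omega (H : V -> 'M[R[i]]_N) x v T :
  (forall y, closure Omega y -> G y = H y) ->
  line_through Omega x v T -> T <= L ->
  exists th, line_evolution H x v T =
    (cos th +i* sin th)%C *: Phi (x, T *: v, T, 1).
Proof.
move=> GH [T0 _ seg _ _] TL.
have TL' : 0 < T <= L by rewrite T0.
have cG : continuous (fun t : R => G (x + t *: v)).
  move=> t; apply: (@continuous_comp _ _ _ (fun t : R => x + t *: v));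
    last exact: Gcont.
  by apply: cvgD; [exact: cvg_cst|apply: cvgZl; exact: cvg_id].
have [th th0 fl] := flow_trace_free N_gt0 cG (fun t =>
  Gherm _) (line_propagator_chord x v TL').
exists (th T); rewrite /line_evolution.
rewrite (time_evolution_flow T0 _ (fun t => Gherm _) fl); last 2 first.
- by move=> t tT; rewrite GH//; exact: seg.
- rewrite th0 mulr0 Phi0 cos0 sin0; exact: scale1r.
by rewrite mulVf ?gt_eqF.
Qed.

(** Composition of propagators, by uniqueness: going from the base point [x] past time [s] is the
    same as restarting at [x + s *: v] with the chord propagator. *)
Lemma line_propagator_continuation x v (T s : R) : 0 < T <= L -> 1 <= L ->
  Phi (x, v, 1, s + T) = Phi (x + s *: v, T *: v, T, 1) *m Phi (x, v, 1, s).
Proof.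
move=> TL L1; have T0 : 0 < T by case/andP: TL.
have fl := line_propagator_chord (x + s *: v) v TL.
have fl2 := line_propagator_unit x v s L1.
have := schrodinger_flow_unique fl _ (fun t => G0herm _) (Psi := fun t =>
  Phi (x, v, 1, s + t)).
rewrite mulr0 Phi0 => /(_ erefl _ T); rewrite mulVf ?gt_eqF// addr0; apply.
move: fl2 => /schrodinger_flow_eq; apply=> t //.
by rewrite scalerDl addrA.
Qed.

End line_evolution.

(** * Removal of the phase by connectedness of the boundary *)

Section phase_rigidity.
Context {R : realType} (n N : nat).
Local Notation V := 'rV[R]_n.

Lemma closed_complex_zeros (X : topologicalType) (h : X -> R[i]) :
  continuous h -> closed [set x | h x = 0].
Proof.
move=> /continuous_complex[cRe cIm].
rewrite (_ : [set x | h x = 0] = (fun x =>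
  complex.Re (h x)) @^-1` [set r | r = 0] `&`
    (fun x => complex.Im (h x)) @^-1` [set r | r = 0]).
  apply: closedI; apply: preimage_closed; try exact: closed_eq.
  - by move=> x _; exact: cRe.
  - by move=> x _; exact: cIm.
by apply/seteqP; split=> [x /= ->//|x [/= h1 h2]]; exact: complex_ext.
Qed.

(* A scalar [g] relating two matrices of determinant 1 is an [N]-th root of
   unity, so [g = 1] and [\sum_(k < N) g ^+ k = 0] are closed complementary
   conditions on the connected boundary. *)
Lemma phase_rigidity (Omega : set V) (U1 U2 : V -> 'M[R[i]]_N) p : (2 <= n)%N ->
  (0 < N)%N -> open Omega -> Omega !=set0 ->
  convex_set (Omega : set (convex_lmodType V)) -> bounded_set Omega ->
  continuous U1 -> continuous U2 -> (forall q, U2 q \is unitarymx) ->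
  (forall q, \det (U1 q) = 1) -> (forall q, \det (U2 q) = 1) ->
  boundary Omega p -> U1 p = U2 p ->
  (forall q, boundary Omega q -> exists z, U1 q = z *: U2 q) ->
  forall q, boundary Omega q -> U1 q = U2 q.
Proof.
move=> n2 N0 oO O0 cO bO c1 c2 u2 d1 d2 bp ep hz q bq.
(* A formula for the scalar relating [U1 q] to [U2 q], continuous on the whole space although the
   relation is assumed only on the boundary. *)
pose g q : R[i] := N%:R^-1 * \tr ((U2 q)^t* *m U1 q).
have N0' : N%:R != 0 :> R[i] by rewrite pnatr_eq0 -lt0n.
have gE y z : U1 y = z *: U2 y -> g y = z.
  move=> e; rewrite /g e -scalemxAr mxtraceZ.
  have /unitarymxP := u2 y; move/mulmx1C => ->.
  by rewrite mxtrace1 mulrCA mulVf// mulr1.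
have cst (z : R[i]) : continuous (fun _ : V => z) by move=> y;
  exact: cst_continuous.
have cg : continuous g.
  apply: complexM_continuous; first exact: cst.
  exact: (mxtrace_continuous (mulmx_continuous (adjmx_continuous c2) c1)).
have ceq : continuous (fun y => g y - 1).
  by apply: complexB_continuous; [exact: cg|exact: cst].
have csum : continuous (fun y => \sum_(k < N) g y ^+ k).
  exact: (complex_sum_continuous (f := fun (k : 'I_N) y => g y ^+ k)
    (fun k => complexX_continuous (k := k) cg)).
have : [set y | g y - 1 = 0] q.
  apply: (boundary_connected n2 oO O0 cO bO (closed_complex_zeros ceq)
    (closed_complex_zeros csum) _ _ bp _ bq).
  - rewrite -subset0 => y [/= /subr0_eq -> ].
    under eq_bigr do rewrite expr1n.
    by rewrite sumr_const card_ord => /eqP; rewrite (negbTE N0').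
  - move=> y /hz[z e]; have gz := gE _ _ e.
    have : g y ^+ N - 1 = 0.
      by rewrite gz; have := d1 y; rewrite e detZ d2 mulr1 => ->; rewrite subrr.
    by rewrite subrX1 => /eqP; rewrite mulf_eq0 => /orP[/eqP|/eqP]; [left|right].
  - by rewrite /= (gE p 1) ?subrr// scale1r.
move=> /= /subr0_eq g1; have [z e] := hz q bq.
by rewrite e -(gE _ _ e) g1 scale1r.
Qed.
End phase_rigidity.

Lemma amplitude_phase (R : realType) N (th : R) a (U : 'M[R[i]]_N) b :
  amplitude a ((cos th +i* sin th)%C *: U) b = amplitude a U b.
Proof.
rewrite /amplitude -scalemxAr -scalemxAl mxE normrM.
by rewrite normc_def /= cos2Dsin2 sqrtr1 mul1r.
Qed.

(** * Determination of the trace free part *)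

Unset Implicit Arguments.

Theorem theorem5p2 (R : realType) (n N : nat) (hn : (2 <= n)%N)
    (hN : (2 <= N)%N) (Omega : set 'rV[R]_n)
    (hOmega : convex_bounded_smooth_domain Omega)
    (I F : set 'cV[R[i]]_N) (hIF : ideal_data I F)
    (hinj : forall W : 'rV[R]_n * 'rV[R]_n -> 'M[R[i]]_(N ^ 2),
      {within sphere_bundle Omega, continuous W} ->
      (forall p, sphere_bundle Omega p -> special_unitary (W p)) ->
      xray_injective Omega W)
    (H H' : 'rV[R]_n -> 'M[R[i]]_N)
    (Hcont : {within closure Omega, continuous H})
    (H'cont : {within closure Omega, continuous H'})
    (Hherm : forall x, closure Omega x -> H x \is hermsymmx)
    (H'herm : forall x, closure Omega x -> H' x \is hermsymmx)
    (hdata : forall a b x v T, F a -> I b -> line_through Omega x v T ->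
      amplitude a (line_evolution H x v T) b =
      amplitude a (line_evolution H' x v T) b) :
  forall x, closure Omega x -> trace_free_part (H x) = trace_free_part (H' x).
Proof.
have N0 : (0 < N)%N by exact: ltnW.
have [oO O0 _ cO bO _] := hOmega.
have kO := compact_closure bO.
have [G1 [C1 [GH1 cG1 hG1 [C1_0 bG1]]]] := hermitian_extension kO Hcont Hherm.
have [G2 [C2 [GH2 cG2 hG2 [C2_0 bG2]]]] := hermitian_extension kO H'cont H'herm.
(* [L] bounds all chord lengths and is at least 1, so the clamp is inactive for chords and for unit
   speed lines alike. *)
have [L [L1 hL]] : exists L : R, 1 <= L /\
    forall p q, boundary Omega p -> boundary Omega q -> euclidean_norm (q - p) <= L.
  have c : continuous (fun u : 'rV[R]_n * 'rV[R]_n => euclidean_norm (u.2 - u.1)).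
    move=> u; apply: (@continuous_comp _ _ _ (fun u : 'rV[R]_n * 'rV[R]_n =>
      u.2 - u.1));
      last exact: euclidean_norm_continuous.
    move: u; apply/continuous_mx => i j; under eq_fun do rewrite !mxE.
    have c1 : continuous (fun u : 'rV[R]_n * 'rV[R]_n => u.1 i j).
      by move=> u; apply: (@continuous_comp _ _ _ fst (fun x : 'rV[R]_n =>
        x i j)); [exact: cvg_fst|exact: coord_continuous].
    have c2 : continuous (fun u : 'rV[R]_n * 'rV[R]_n => u.2 i j).
      by move=> u; apply: (@continuous_comp _ _ _ snd (fun x : 'rV[R]_n =>
        x i j)); [exact: cvg_snd|exact: coord_continuous].
    by move=> u; apply: cvgB; [exact: c2|exact: c1].
  have kB := compact_boundary bO.
  have /compact_bounded[M [_ hM]] :=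
    continuous_compact (continuous_subspaceT c) (compact_setX kB kB).
  exists (`|M| + 1); split=> [|p q bp bq]; first by rewrite lerDr.
  have := hM (`|M| + 1) _ (euclidean_norm (q - p)).
  have -> : M < `|M| + 1 by rewrite (le_lt_trans (ler_norm M))// ltrDl.
  move=> /(_ isT) h; apply: le_trans (ler_norm _) (h _).
  by exists (p, q).
have L0 : 0 <= L by exact: le_trans L1.
have [Phi1 [cP1 P10 fl1]] := line_propagator (trace_free_part_continuous cG1)
  (mulr_ge0 (ler0n R 2) C1_0) (fun x => trace_free_part_bound N0 C1_0 (bG1 x)) L0.
have [Phi2 [cP2 P20 fl2]] := line_propagator (trace_free_part_continuous cG2)
  (mulr_ge0 (ler0n R 2) C2_0) (fun x => trace_free_part_bound N0 C2_0 (bG2 x)) L0.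
have u1 := line_propagator_unitary hG1 P10 fl1.
have u2 := line_propagator_unitary hG2 P20 fl2.
have d1 := line_propagator_det N0 P10 fl1.
have d2 := line_propagator_det N0 P20 fl2.
(* Parameters of the chord run in unit time; they are continuous in [q], also at [q = p]. *)
pose chord (p q : 'rV[R]_n) := (p, q - p, euclidean_norm (q - p), 1 : R).
have cB (p : 'rV[R]_n) : continuous (fun q : 'rV[R]_n => q - p).
  apply: (@affine_continuous _ _ (- p) 1) => q.
  by rewrite scale1r addrC.
have cchord p : continuous (chord p).
  apply: pair_continuous; last by move=> q; exact: cst_continuous.
  apply: pair_continuous; last first.
    by move=> q; apply: (continuous_comp (cB p q));
      exact: euclidean_norm_continuous.
  by apply: pair_continuous; [move=> q; exact: cst_continuous|exact: cB].
have agree p q : boundary Omega p -> boundary Omega q ->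
    Phi1 (chord p q) = Phi2 (chord p q).
  move=> bp bq.
  have Epp : Phi1 (chord p p) = Phi2 (chord p p).
    have e : chord p p = (p, p - p, 0, 1).
      by rewrite /chord subrr -(scale0r (0 : 'rV[R]_n)) euclidean_normZ normr0
        mul0r.
    by rewrite e (line_propagator_degenerate P10 fl1)//
      (line_propagator_degenerate P20 fl2).
  have c1 : continuous (fun q => Phi1 (chord p q)).
    by move=> y; apply: (continuous_comp (cchord p y)); exact: cP1.
  have c2 : continuous (fun q => Phi2 (chord p q)).
    by move=> y; apply: (continuous_comp (cchord p y)); exact: cP2.
  have hz y : boundary Omega y ->
    exists z, Phi1 (chord p y) = z *: Phi2 (chord p y).
    (* The chord from [p] to itself is not a line and carries no data, but both propagators are the
       identity there. *)
    move=> by_; have [<-|py] := eqVneq p y.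
      by exists 1; rewrite scale1r.
    have lt := chord_line_through oO cO bp by_ py.
    set T := euclidean_norm (y - p) in lt; set v := T^-1 *: (y - p) in lt.
    have TL : T <= L by exact: hL.
    have Tv : T *: v = y - p.
      have [T0 _ _ _ _] := lt.
      by rewrite scalerA mulfV ?gt_eqF// scale1r.
    have [t1 e1] := line_evolution_propagator N0 cG1 hG1 P10 fl1 GH1 lt TL.
    have [t2 e2] := line_evolution_propagator N0 cG2 hG2 P20 fl2 GH2 lt TL.
    rewrite Tv -/(chord p y) in e1 e2.
    have amp a b : F a -> I b ->
        amplitude a (Phi1 (chord p y)) b = amplitude a (Phi2 (chord p y)) b.
      (* The phases [t1] and [t2] from the traces drop out, so the data pass to the trace free
         propagators. *)
      move=> Fa Ib; have := hdata a b p v T Fa Ib lt.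
      by rewrite e1 e2 !amplitude_phase.
    have [phi ->] := hIF _ _ (u1 (chord p y)) (u2 (chord p y)) amp.
    by eexists.
  exact: (phase_rigidity hn N0 oO O0 cO bO c1 c2 (fun y => u2 (chord p y))
    (fun y => d1 (chord p y)) (fun y => d2 (chord p y)) bp Epp hz bq).
(* The foot of the perpendicular from the origin, the direction, unit speed, and the signed distance
   from the foot to the point as time. *)
pose base (u : 'rV[R]_n * 'rV[R]_n) := (u.1 - dot u.1 u.2 *: u.2, u.2, 1 : R,
  dot u.1 u.2).
have cbase : continuous base.
  have cd := @dot_continuous R n.
  have cv : continuous (fun u : 'rV[R]_n * 'rV[R]_n => u.2) by move=> u;
    exact: cvg_snd.
  apply: pair_continuous; last exact: cd.
  apply: pair_continuous; last by move=> u; exact: cst_continuous.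
  apply: pair_continuous; last exact: cv.
  apply/continuous_mx => i j; under eq_fun do rewrite !mxE.
  have c1 : continuous (fun u : 'rV[R]_n * 'rV[R]_n => u.1 i j).
    by move=> u; apply: (@continuous_comp _ _ _ fst (fun x : 'rV[R]_n =>
      x i j)); [exact: cvg_fst|exact: coord_continuous].
  have c2 := (continuous_mx _).1 cv i j.
  by move=> u; apply: cvgB; [exact: c1|apply: cvgM; [exact: cd|exact: c2]].
(* [N ^ 2] is convertible to [N * N], the size of the tensor product. *)
pose W u : 'M[R[i]]_(N ^ 2) := mxtens.tensmx ((Phi1 (base u))^t*) ((Phi2 (base
  u))^T).
pose f x : 'cV[R[i]]_(N ^ 2) := mx_col (trace_free_part (G1 x) -
  trace_free_part (G2 x)).
have cPb (Phi : 'rV[R]_n * 'rV[R]_n * R * R -> 'M[R[i]]_N) :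
    continuous Phi -> continuous (fun u => Phi (base u)).
  by move=> cP u; apply: (continuous_comp (cbase u)); exact: cP.
have cW : continuous W.
  exact: (tensmx_continuous (adjmx_continuous (cPb _ cP1)) (trmx_continuous
    (cPb _ cP2))).
have sW u : special_unitary (W u).
  apply: special_unitary_tens.
    by apply: special_unitary_adj; split; [exact: u1|exact: d1].
  by apply: special_unitary_tr; split; [exact: u2|exact: d2].
have cG : continuous (fun x => trace_free_part (G1 x) - trace_free_part (G2 x)).
  exact: (mxB_continuous (trace_free_part_continuous cG1)
    (trace_free_part_continuous cG2)).
have cf : continuous f := mx_col_continuous cG.
suff f0 x : closure Omega x -> f x = 0.
  move=> x Ox; rewrite -GH1// -GH2//; apply/eqP; rewrite -subr_eq0; apply/eqP.
  exact: mx_col_eq0 (f0 x Ox).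
apply: (hinj W) => //; [exact: continuous_subspaceT|exact: continuous_subspaceT|].
move=> {}x v T lt; have [T0 sv seg b0 bT] := lt.
have seg0 : segment_path x v 0 = x by rewrite /segment_path scale0r addr0.
rewrite seg0 in b0.
have Tx : segment_path x v T - x = T *: v by rewrite /segment_path addrC addKr.
have nT : euclidean_norm (segment_path x v T - x) = T.
  by rewrite Tx euclidean_normZ sv mulr1 gtr0_norm.
have TL : 0 < T <= L by rewrite T0 -nT; exact: hL.
set b := x - dot x v *: v; set s := dot x v.
(* Along a line the foot is constant and time advances at unit rate, so the weight follows a single
   pair of flows. *)
have baseE t : base (segment_path x v t, v) = (b, v, 1, s + t).
  rewrite /base /= dot_line// /segment_path; congr (_, _, _, _).
  by rewrite scalerDl opprD addrACA subrr addr0.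
have bs t : b + (s + t) *: v = segment_path x v t.
  by rewrite scalerDl addrA subrK.
pose D t := (Phi1 (b, v, 1, s + t))^t* *m Phi2 (b, v, 1, s + t).
have xbs : b + s *: v = x by rewrite subrK.
have e1 : Phi1 (b, v, 1, s + T) = Phi1 (x, T *: v, T, 1) *m Phi1 (b, v, 1, s).
  by rewrite -{1}xbs; exact: (line_propagator_continuation hG1 P10 fl1).
have e2 : Phi2 (b, v, 1, s + T) = Phi2 (x, T *: v, T, 1) *m Phi2 (b, v, 1, s).
  by rewrite -{1}xbs; exact: (line_propagator_continuation hG2 P20 fl2).
(* Both propagators at the exit factor through the same chord matrix, which cancels by unitarity. *)
have DT : D T = D 0.
  rewrite /D addr0 e1 e2.
  have := agree x _ b0 bT; rewrite /chord nT Tx => ->.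
  rewrite trmx_mul map_mxM mulmxA -(mulmxA _ _ (Phi2 (x, _, _, _))).
  by have /unitarymxP/mulmx1C -> := u2 (x, T *: v, T, 1); rewrite mulmx1.
pose Y t := (Phi1 (b, v, 1, s + t))^t* *m
  (trace_free_part (G1 (segment_path x v t)) - trace_free_part (G2
    (segment_path x v t)))
  *m Phi2 (b, v, 1, s + t).
have dD t : mderive D t ('i%C *: Y t).
  have := schrodinger_flow_adj_mul (t := t) (line_propagator_unit fl1 b v s L1)
    (line_propagator_unit fl2 b v s L1) (trace_free_part_hermitian (hG1 _)).
  by rewrite bs.
have cY : continuous Y.
  have cPt (Phi : 'rV[R]_n * 'rV[R]_n * R * R -> 'M[R[i]]_N) :
      continuous Phi -> continuous (fun t => Phi (b, v, 1, s + t)).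
    move=> cP; apply: (pair_comp_continuous (f := Phi) (g := fun=> (b, v, 1))
      (h := fun t => s + t)) => // t.
      exact: cst_continuous.
    by apply: cvgD; [exact: cvg_cst|exact: cvg_id].
  have cGt : continuous (fun t => trace_free_part (G1 (segment_path x v t)) -
      trace_free_part (G2 (segment_path x v t))).
    have cs : continuous (segment_path x v).
      by move=> t; apply: cvgD; [exact: cvg_cst|apply: cvgZl; exact: cvg_id].
    move=> t; exact: (@continuous_comp _ _ _ (segment_path x v)
      (fun y => trace_free_part (G1 y) - trace_free_part (G2 y)) t (cs t) (cG _)).
  exact: (mulmx_continuous (mulmx_continuous (adjmx_continuous (cPt _ cP1))
    cGt) (cPt _ cP2)).
apply/matrixP => k l; rewrite !mxE.
set a := (mxtens.mxtens_unindex k).1; set c := (mxtens.mxtens_unindex k).2.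
have -> : (fun t => (W (segment_path x v t, v) *m f (segment_path x v t)) k ord0) =
    fun t => Y t a c.
  by apply/funext => t; rewrite /W /f baseE tens_mx_col trmxK mxE.
(* The factor [-i] cancels the [i] in the derivative of [D]; the integral is then [-i] times an
   entry of [D T - D 0]. *)
rewrite (@complex_integral_derive _ _ (fun t => - 'i%C * D t a c))//.
- by rewrite DT subrr.
- exact: continuous_entry cY.
- move=> t; apply: cderive_eq (cderiveZ (- 'i%C) (dD t a c)) _ _ => //.
  by rewrite mxE mulrA mulNr -expr2 sqr_i opprK mul1r.
Qed.
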